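(* Let $R$ be a field of characteristic $p\ge0$, let $S$ be a quasi-thin association scheme of size $d$ on a nonempty finite set $X$, let $x\in X$, and let $\mathcal{T}=\mathcal{T}_R(x)$ be the Terwilliger $R$-algebra of $S$ with respect to $x$. Then the following hold. (1) $\mathcal{T}$ is a quasi-hereditary algebra, and it is a cellular algebra with respect to the matrix transpose (that is, it has a cell datum whose involution is $a\mapsto a^t$). (2) If $R$ has characteristic $2$ and $\mathcal{A}_2:=\{i\in[d]\mid k_i=2\}$ has $r\ge0$ equivalence classes under the equivalence relation $\sim$, then the basic algebra $\Gamma$ of $\mathcal{T}$ is isomorphic to the $R$-algebra $\Lambda$ given by the quiver with vertices $0,1,\ldots,r$ and arrows $\alpha_i:i\to0$ and $\beta_i:0\to i$ for $1\le i\le r$, with relations $\alpha_i\beta_i=0$ for $1\le i\le r$. Here $\alpha_i\beta_i$ denotes the path $0\to i\to0$ (first $\beta_i$, then $\alpha_i$).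
   Context: **Notation.** For $n\in\mathbb{N}$, $[n]=\{0,1,\ldots,n\}$. **Association schemes.** An association scheme (scheme) of size $d$ on a nonempty finite set $X$ is a partition $S=\{R_0,R_1,\ldots,R_d\}$ of $X\times X$ with all parts $R_i$ nonempty such that: (S1) $R_0=\{(x,x)\mid x\in X\}$; (S2) for each $i\in[d]$ there is $i'\in[d]$ with $R_{i'}=\{(x,y)\mid (y,x)\in R_i\}$; (S3) for $i,j,\ell\in[d]$ and $(x,y)\in R_\ell$, the number $p_{ij}^\ell:=|\{z\in X\mid (x,z)\in R_i,\ (z,y)\in R_j\}|$ does not depend on the choice of $(x,y)\in R_\ell$. The valency of $R_i$ is $k_i:=p_{ii'}^0$; it equals $|xR_i|$ for every $x\in X$, where $xR_i:=\{y\in X\mid (x,y)\in R_i\}$. The scheme $S$ is quasi-thin if $k_i\le 2$ for all $i\in[d]$. **Terwilliger algebra.** Let $M_X(R)$ be the algebra of $X\times X$ matrices over $R$, with matrix units $E_{yz}$; $a^t$ denotes the transpose of $a$. For $i\in[d]$, the adjacency matrix $A_i\in M_X(R)$ has $(y,z)$-entry $1$ if $(y,z)\in R_i$ and $0$ otherwise. For $x\in X$, put $E_i^*(x):=\sum_{y\in xR_i}E_{yy}$. The Terwilliger $R$-algebra $\mathcal{T}_R(x)$ of $S$ with respect to $x$ is the $R$-subalgebra of $M_X(R)$ generated by $A_0,\ldots,A_d,E_0^*(x),\ldots,E_d^*(x)$. **The relation $\sim$ on $\mathcal{A}_2$.** For nonempty $U,V\subseteq S$ let $UV:=\{R_\ell\in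 S\mid \exists R_i\in U,\ \exists R_j\in V,\ p_{ij}^\ell>0\}$; write $R_iR_j$ for $\{R_i\}\{R_j\}$. Let $n\in\mathbb{N}$ (including $n=0$). If there are $i_b,j_b,\ell_b\in[d]$ for all $b\in[n]$ such that (1) $k_{i_b}=k_{\ell_b}=2$ and $p_{i_bj_b}^{\ell_b}=1$ for all $b\in[n]$, and (2) $|R_{i_0'}R_{\ell_n}|=1$ and $\ell_c=i_{c+1}$ for all $0\le c\le n-1$, then $(i_0,\ell_n)$ is called a bad pair of $S$. Let $\mathcal{S}$ be the set of all bad pairs, $\mathcal{R}:=\{(i,j)\in\mathcal{A}_2\times\mathcal{A}_2\mid |R_{i'}R_j|=2\}$, and $\mathcal{U}:=\mathcal{R}\cup\mathcal{S}$. For $i,j\in\mathcal{A}_2$, define $i\sim j$ if and only if $(i,j)\in\mathcal{U}$. It is known that $\sim$ is an equivalence relation on $\mathcal{A}_2$ (with $r=0$ classes if $\mathcal{A}_2=\emptyset$). **Cellular algebra (Graham-Lehrer).** A unitary $R$-algebra $A$ is cellular if there is a cell datum $(I,M,C,t)$ such that: (C1) $I$ is a finite partially ordered set, to each $\lambda\in I$ is associated a finite set $M(\lambda)$, and $A$ has an $R$-basis consisting of elements $C^\lambda_{U,V}$ with $(U,V)\in M(\lambda)\times M(\lambda)$ and $\lambda\in I$; (C2) $t$ is an $R$-linear anti-automorphism of $A$ with $t^2=\mathrm{id}$, sending $C^\lambda_{U,V}$ to $C^\lambda_{V,U}$; (C3) for each $a\in A$, $aC^\lambda_{U,V}=\sum_{W\in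 M(\lambda)}r_a(W,U)C^\lambda_{W,V}+r'$, where $r_a(W,U)\in R$ does not depend on $V$ and $r'$ is a linear combination of basis elements with upper index $\mu<\lambda$. **Quasi-hereditary algebra (Cline-Parshall-Scott).** An ideal $J$ of a finite-dimensional algebra $A$ over a field is a heredity ideal if $J$ is idempotent ($J^2=J$), $J\,\mathrm{rad}(A)\,J=0$, and $J$ is projective as a left (or right) $A$-module. $A$ is quasi-hereditary if there is a finite chain of ideals $0=J_0\subset J_1\subset\cdots\subset J_n=A$ such that $J_j/J_{j-1}$ is a heredity ideal of $A/J_{j-1}$ for all $j$. **Basic algebra.** For a finite-dimensional algebra $A$ over a field, let $P_1,\ldots,P_n$ be a complete set of non-isomorphic indecomposable projective $A$-modules. The basic algebra of $A$ is the endomorphism algebra of the $A$-module $\bigoplus_{i=1}^nP_i$. *)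

(* Defs.v *)
From HB Require Import structures.
From mathcomp Require Import all_boot all_order all_algebra all_field.
From mathcomp Require Import boolp.
From mathcomp Require Import finmap monalg.

Set Implicit Arguments.
Unset Strict Implicit.
Unset Printing Implicit Defensive.

Import GRing.Theory.
Local Open Scope ring_scope.

(* A scheme of size d: the parts are R_0, ..., R_d, pairwise distinct by
   [rel_inj] and nonempty because [partition] excludes set0. *)
Record scheme (d : nat) (X : finType) := Scheme {
  srel :> 'I_d.+1 -> {set X * X};
  rel_inj : injective srel;
  rel_partition : partition [set srel i | i : 'I_d.+1] [set: X * X];
  rel_diag : srel ord0 = [set u | u.1 == u.2];
  rel_transpose :
    forall i, exists i', srel i' = [set u | (u.2, u.1) \in srel i];
  rel_regular :
    forall i j l (u v : X * X), u \in srel l -> v \in srel l ->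
      #|[set z | ((u.1, z) \in srel i) && ((z, u.2) \in srel j)]|
      = #|[set z | ((v.1, z) \in srel i) && ((z, v.2) \in srel j)]| }.

Section SchemeTheory.
Variables (d : nat) (X : finType) (S : scheme d X).
Implicit Types (i j l : 'I_d.+1) (U V : {set 'I_d.+1}).

Definition transp i : 'I_d.+1 :=
  odflt ord0 [pick i' | S i' == [set u | (u.2, u.1) \in S i]].

(* p_{ij}^l, computed from an arbitrary element of R_l. *)
Definition pnum i j l : nat :=
  if [pick u in S l] is Some u
  then #|[set z | ((u.1, z) \in S i) && ((z, u.2) \in S j)]| else 0.

Definition valency i : nat := pnum i (transp i) ord0.

Definition quasi_thin : Prop := forall i, (valency i <= 2)%N.

(* Sets of relations are represented by sets of indices. *)
Definition cprod U V : {set 'I_d.+1} :=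
  [set l | [exists i in U, exists j in V, (0 < pnum i j l)%N]].

Definition rprod i j : {set 'I_d.+1} := cprod [set i] [set j].

Definition A2 : {set 'I_d.+1} := [set i | valency i == 2].

(* Only the values of i, j, l on [n] = {0, ..., n} matter. *)
Definition bad_pair (a b : 'I_d.+1) : Prop :=
  exists (n : nat) (i j l : nat -> 'I_d.+1),
    [/\ forall c, (c <= n)%N ->
          [/\ valency (i c) = 2, valency (l c) = 2
            & pnum (i c) (j c) (l c) = 1]%N,
        #|rprod (transp (i 0)) (l n)| = 1%N,
        forall c, (c < n)%N -> l c = i c.+1,
        a = i 0
      & b = l n].

Definition good_pair (a b : 'I_d.+1) : Prop :=
  [/\ a \in A2, b \in A2 & #|rprod (transp a) b| = 2%N].

Definition sim (a b : 'I_d.+1) : Prop := good_pair a b \/ bad_pair a b.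

Definition sim_classes : {set {set 'I_d.+1}} :=
  equivalence_partition (fun a b => `[< sim a b >]) A2.

End SchemeTheory.

(* M_X(F) is realized as square matrices of size #|X| (X is inhabited by the
   base point x), the row or column a being labelled by the a-th element of
   [enum X]; the size is written #|X|.-1.+1 so that the matrices form a
   (nontrivial) algebra. *)
Section Terwilliger.
Variables (F : fieldType) (d : nat) (X : finType) (S : scheme d X) (x : X).

Definition MX : falgType F := 'M[F]_(#|X|.-1.+1).

Definition pt (a : 'I_(#|X|.-1.+1)) : X := nth x (enum X) a.

Lemma pt_bij : bijective pt.
Proof.
have cX : #|X|.-1.+1 = #|X| by rewrite prednK //; apply/card_gt0P; exists x.
apply: inj_card_bij; last by rewrite card_ord cX.
have lt_pt (c : 'I_(#|X|.-1.+1)) : (c < size (enum X))%N.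
  by rewrite -cardE -[X in (_ < X)%N]cX.
by move=> a b /eqP; rewrite nth_uniq ?enum_uniq // => /eqP/val_inj.
Qed.

Definition adj (i : 'I_d.+1) : MX :=
  \matrix_(a, b) ((pt a, pt b) \in S i)%:R.

Definition dual_idem (i : 'I_d.+1) : MX :=
  \sum_(a | (x, pt a) \in S i) delta_mx a a.

Definition terwilliger : {aspace MX} :=
  << << [seq adj i | i : 'I_d.+1] ++ [seq dual_idem i | i : 'I_d.+1] >> >>%AS.

End Terwilliger.

Definition anti_involution (F : fieldType) (A : falgType F)
    (t : {linear A -> A}) : Prop :=
  (forall a b, t (a * b) = t b * t a) /\ involutive t.

Definition cellular_wrt (F : fieldType) (A : falgType F)
    (t : {linear A -> A}) : Prop :=
  exists (disp : Order.disp_t) (I : finPOrderType disp) (M : I -> finType)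
         (C : forall l : I, M l -> M l -> A),
    let idx : finType := {l : I & (M l * M l)%type} in
    let cell (u : idx) : A := C (tag u) (tagged u).1 (tagged u).2 in
    [/\ basis_of fullv [seq cell u | u : idx],
        anti_involution t,
        forall l U V, t (C l U V) = C l V U
      & forall (a : A) (l : I), exists r : M l -> M l -> F, forall U V,
          a * C l U V - \sum_W r W U *: C l W V
            \in <<[seq cell u | u <- enum idx & (tag u < l)%O]>>%VS].

Section Modules.
Variable B : pzRingType.

Definition projective (P : lmodType B) : Prop :=
  forall (M N : lmodType B) (g : {linear M -> N}) (f : {linear P -> N}),
    (forall y, exists x, g x = y) ->
    exists h : {linear P -> M}, forall p, g (h p) = f p.

Definition lmod_iso (M N : lmodType B) : Prop :=
  exists f : {linear M -> N}, bijective f.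

Definition indecomposable (M : lmodType B) : Prop :=
  (exists v : M, v != 0) /\
  forall U V : {pred M}, submod_closed U -> submod_closed V ->
    (forall w, exists u v, [/\ u \in U, v \in V & w = u + v]) ->
    (forall w, w \in U -> w \in V -> w = 0) ->
    (forall u, u \in U -> u = 0) \/ (forall v, v \in V -> v = 0).

Definition submodule (V : lmodType B) (S : submodClosed V) := {v : V | v \in S}.
HB.instance Definition _ (V : lmodType B) (S : submodClosed V) :=
  SubChoice.on (submodule S).
HB.instance Definition _ (V : lmodType B) (S : submodClosed V) :=
  [SubChoice_isSubLmodule of submodule S by <:].

End Modules.

Section DirectSum.
Variables (B : pzRingType) (n : nat) (P : 'I_n -> lmodType B).

Definition dirsum := {dffun forall i : 'I_n, P i}.
HB.instance Definition _ := Choice.on dirsum.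
Implicit Types (f g h : dirsum) (a b : B).

Definition ds0 : dirsum := [ffun i => 0 : P i].
Definition dsN f : dirsum := [ffun i => - f i].
Definition dsD f g : dirsum := [ffun i => f i + g i].
Definition dsZ a f : dirsum := [ffun i => a *: f i].

Fact dsDA : associative dsD.
Proof. by move=> f g h; apply/ffunP=> i; rewrite !ffunE addrA. Qed.
Fact dsDC : commutative dsD.
Proof. by move=> f g; apply/ffunP=> i; rewrite !ffunE addrC. Qed.
Fact ds0D : left_id ds0 dsD.
Proof. by move=> f; apply/ffunP=> i; rewrite !ffunE add0r. Qed.
Fact dsND : left_inverse ds0 dsN dsD.
Proof. by move=> f; apply/ffunP=> i; rewrite !ffunE addNr. Qed.
HB.instance Definition _ := GRing.isZmodule.Build dirsum dsDA dsDC ds0D dsND.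

Fact dsZA a b f : dsZ a (dsZ b f) = dsZ (a * b) f.
Proof. by apply/ffunP=> i; rewrite !ffunE scalerA. Qed.
Fact ds1Z : left_id 1 dsZ.
Proof. by move=> f; apply/ffunP=> i; rewrite !ffunE scale1r. Qed.
Fact dsZDr : right_distributive dsZ +%R.
Proof. by move=> a f g; apply/ffunP=> i; rewrite !ffunE scalerDr. Qed.
Fact dsZDl f : {morph dsZ^~ f : a b / a + b}.
Proof. by move=> a b; apply/ffunP=> i; rewrite !ffunE scalerDl. Qed.
HB.instance Definition _ :=
  GRing.Zmodule_isLmodule.Build B dirsum dsZA ds1Z dsZDr dsZDl.

End DirectSum.

Definition complete_proj_indec (B : pzRingType) (n : nat)
    (P : 'I_n -> lmodType B) : Prop :=
  [/\ forall i, projective (P i) /\ indecomposable (P i),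
      forall i j, i != j -> ~ lmod_iso (P i) (P j)
    & forall Q : lmodType B, projective Q -> indecomposable Q ->
        exists i, lmod_iso Q (P i)].

(* L is isomorphic, as an F-algebra, to End_A(M): product is composition of
   maps, and c in F acts on End_A(M) through the central element c%:A. *)
Definition end_alg_iso (F : fieldType) (A : algType F) (M : lmodType A)
    (L : algType F) : Prop :=
  exists phi : L -> {linear M -> M},
    [/\ forall (k : F) (a b : L) (v : M),
          phi (k *: a + b) v = (k%:A : A) *: phi a v + phi b v,
        forall v, phi 1 v = v,
        forall a b v, phi (a * b) v = phi a (phi b v),
        forall a b, phi a =1 phi b -> a = b
      & forall f : {linear M -> M}, exists a, phi a =1 f].

Record ideal (F : fieldType) (A : algType F) := Ideal {
  ideal_pred :> {pred A};
  ideal_zmod : zmod_closed ideal_pred;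
  ideal_mull : forall a u, u \in ideal_pred -> a * u \in ideal_pred;
  ideal_mulr : forall a u, u \in ideal_pred -> u * a \in ideal_pred }.

HB.instance Definition _ (F : fieldType) (A : algType F) (I : ideal A) :=
  GRing.isZmodClosed.Build A (ideal_pred I) (ideal_zmod I).

Section IdealSubmod.
Variables (F : fieldType) (A : algType F) (I : ideal A).

Definition regular_pred : {pred A^o} := ideal_pred I.

Fact regular_pred_submod : submod_closed regular_pred.
Proof.
split=> [|a u v uI vI]; first exact: (ideal_zmod I).1.
have vI' : (v : A) \in ideal_pred I by [].
have := rpredD (ideal_mull a uI) vI'; exact.
Qed.

HB.instance Definition _ :=
  GRing.isSubmodClosed.Build A A^o regular_pred regular_pred_submod.

Definition ideal_lmod : lmodType A := submodule regular_pred.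

End IdealSubmod.

Section QuotientAlgebra.
Variables (F : fieldType) (A : algType F) (I : ideal A) (I1 : 1 \notin I).

Local Open Scope quotient_scope.

Definition qalg := let _ := I1 in Quotient.quot (ideal_pred I).
HB.instance Definition _ := GRing.Zmodule.on qalg.
HB.instance Definition _ := EqQuotient.on qalg.

Definition qpi (a : A) : qalg := \pi_qalg a.

Lemma qpi_surj (u : qalg) : {a : A | u = qpi a}.
Proof. by exists (repr u); rewrite /qpi reprK. Qed.

Lemma qpi_eq (a b : A) : (qpi a == qpi b) = (a - b \in I).
Proof. exact: (esym (Quotient.idealrBE (ideal_pred I) a b)). Qed.

Fact qpi_is_zmod_morphism : zmod_morphism qpi.
Proof.
move=> a b; rewrite [LHS](Quotient.pi_add (ideal_pred I)).
by congr (_ + _); exact: (Quotient.pi_opp (ideal_pred I)).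
Qed.
HB.instance Definition _ :=
  GRing.isZmodMorphism.Build A qalg qpi qpi_is_zmod_morphism.

Definition qmul (u v : qalg) : qalg := qpi (repr u * repr v).
Definition qscale (k : F) (u : qalg) : qalg := qpi (k *: repr u).

Lemma qpi_reprB (a : A) : repr (qpi a) - a \in I.
Proof. by rewrite -qpi_eq /qpi reprK. Qed.

Lemma qmulE a b : qmul (qpi a) (qpi b) = qpi (a * b).
Proof.
apply/eqP; rewrite qpi_eq.
have -> : repr (qpi a) * repr (qpi b) - a * b =
  (repr (qpi a) - a) * repr (qpi b) + a * (repr (qpi b) - b).
  by rewrite mulrBl mulrBr addrA subrK.
by apply: rpredD; [apply: ideal_mulr | apply: ideal_mull]; exact: qpi_reprB.
Qed.

Lemma qscaleE k a : qscale k (qpi a) = qpi (k *: a).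
Proof.
apply/eqP; rewrite qpi_eq -scalerBr -mulr_algl.
by apply: ideal_mull; exact: qpi_reprB.
Qed.

Lemma qind (P : qalg -> Prop) : (forall a, P (qpi a)) -> forall u, P u.
Proof. by move=> Pq u; case: (qpi_surj u) => a ->. Qed.

Fact qmulA : associative qmul.
Proof.
move=> u v w; elim/qind: u => a; elim/qind: v => b; elim/qind: w => c.
by rewrite !qmulE mulrA.
Qed.
Fact qmul1 : left_id (qpi 1) qmul.
Proof. by move=> u; elim/qind: u => a; rewrite qmulE mul1r. Qed.
Fact qmulr1 : right_id (qpi 1) qmul.
Proof. by move=> u; elim/qind: u => a; rewrite qmulE mulr1. Qed.
Fact qmulDl : left_distributive qmul +%R.
Proof.
move=> u v w; elim/qind: u => a; elim/qind: v => b; elim/qind: w => c.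
by rewrite -raddfD !qmulE -raddfD mulrDl.
Qed.
Fact qmulDr : right_distributive qmul +%R.
Proof.
move=> u v w; elim/qind: u => a; elim/qind: v => b; elim/qind: w => c.
by rewrite -raddfD !qmulE -raddfD mulrDr.
Qed.
Fact qone_neq0 : qpi 1 != 0.
Proof. by rewrite -(raddf0 qpi) qpi_eq subr0. Qed.
HB.instance Definition _ :=
  GRing.Zmodule_isNzRing.Build qalg qmulA qmul1 qmulr1 qmulDl qmulDr qone_neq0.

Fact qscaleA k l u : qscale k (qscale l u) = qscale (k * l) u.
Proof. by elim/qind: u => a; rewrite !qscaleE scalerA. Qed.
Fact qscale1 : left_id 1 qscale.
Proof. by move=> u; elim/qind: u => a; rewrite qscaleE scale1r. Qed.
Fact qscaleDr : right_distributive qscale +%R.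
Proof.
move=> k u v; elim/qind: u => a; elim/qind: v => b.
by rewrite -raddfD !qscaleE -raddfD scalerDr.
Qed.
Fact qscaleDl u : {morph qscale^~ u : k l / k + l}.
Proof.
by move=> k l; elim/qind: u => a; rewrite !qscaleE -raddfD scalerDl.
Qed.
HB.instance Definition _ :=
  GRing.Zmodule_isLmodule.Build F qalg qscaleA qscale1 qscaleDr qscaleDl.

Lemma qpiM a b : qpi a * qpi b = qpi (a * b). Proof. exact: qmulE. Qed.
Lemma qpiZ k a : k *: qpi a = qpi (k *: a). Proof. exact: qscaleE. Qed.

Fact qscaleAl k (u v : qalg) : k *: (u * v) = (k *: u) * v.
Proof.
elim/qind: u => a; elim/qind: v => b.
by rewrite !(qpiM, qpiZ) scalerAl.
Qed.
HB.instance Definition _ := GRing.Lmodule_isLalgebra.Build F qalg qscaleAl.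

Fact qscaleAr k (u v : qalg) : k *: (u * v) = u * (k *: v).
Proof.
elim/qind: u => a; elim/qind: v => b.
by rewrite !(qpiM, qpiZ) scalerAr.
Qed.
HB.instance Definition _ := GRing.Lalgebra_isAlgebra.Build F qalg qscaleAr.

(* The image of an ideal J of A in A / I, that is, J / I when J contains I. *)
Section Image.
Variable J : ideal A.

Definition qimage_pred : {pred qalg} :=
  fun u => `[< exists2 a, a \in J & u = qpi a >].

Fact qimage_zmod : zmod_closed qimage_pred.
Proof.
split=> [|u v]; first by apply/asboolP; exists 0; rewrite ?raddf0 ?rpred0.
move=> /asboolP[a aJ ->] /asboolP[b bJ ->]; apply/asboolP.
by exists (a - b); rewrite ?raddfB ?rpredB.
Qed.
Fact qimage_mull u v : v \in qimage_pred -> u * v \in qimage_pred.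
Proof.
case: (qpi_surj u) => a -> /asboolP[b bJ ->]; apply/asboolP.
by exists (a * b); [apply: ideal_mull | rewrite -qmulE].
Qed.
Fact qimage_mulr u v : v \in qimage_pred -> v * u \in qimage_pred.
Proof.
case: (qpi_surj u) => a -> /asboolP[b bJ ->]; apply/asboolP.
by exists (b * a); [apply: ideal_mulr | rewrite -qmulE].
Qed.

Definition qimage : ideal qalg := Ideal qimage_zmod qimage_mull qimage_mulr.
End Image.

End QuotientAlgebra.

Section GeneratedIdeal.
Variables (F : fieldType) (A : algType F) (G : A -> Prop).

Definition gen_pred : {pred A} :=
  fun a => `[< forall J : ideal A, (forall g, G g -> g \in J) -> a \in J >].

Fact gen_zmod : zmod_closed gen_pred.
Proof.
split=> [|u v /asboolP uG /asboolP vG]; apply/asboolP=> J GJ; first exact: rpred0.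
by rewrite rpredB ?uG ?vG.
Qed.
Fact gen_mull a u : u \in gen_pred -> a * u \in gen_pred.
Proof. by move=> /asboolP uG; apply/asboolP=> J /uG; apply: ideal_mull. Qed.
Fact gen_mulr a u : u \in gen_pred -> u * a \in gen_pred.
Proof. by move=> /asboolP uG; apply/asboolP=> J /uG; apply: ideal_mulr. Qed.

Definition gen_ideal : ideal A := Ideal gen_zmod gen_mull gen_mulr.
End GeneratedIdeal.

Section QuasiHereditary.
Variable F : fieldType.

Definition left_ideal (A : algType F) (M : {pred A^o}) : Prop :=
  submod_closed M.

Definition max_left_ideal (A : algType F) (M : {pred A^o}) : Prop :=
  [/\ left_ideal M, 1 \notin M
    & forall N : {pred A^o}, left_ideal N -> 1 \notin N ->
        {subset M <= N} -> {subset N <= M}].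

Definition jacobson (A : algType F) (a : A) : Prop :=
  forall M : {pred A^o}, max_left_ideal M -> a \in M.

(* J^2 = J is stated as J <= J^2, the other inclusion being automatic;
   projectivity is that of J as a left module. *)
Definition heredity (A : algType F) (J : ideal A) : Prop :=
  [/\ forall u, u \in J -> exists s : seq (A * A),
        (forall w, w \in s -> w.1 \in J /\ w.2 \in J) /\
        u = \sum_(w <- s) w.1 * w.2,
      forall u a v, u \in J -> jacobson a -> v \in J -> u * a * v = 0
    & projective (ideal_lmod J)].

Definition quasi_hereditary (A : falgType F) : Prop :=
  exists (n : nat) (J : nat -> ideal A),
    [/\ forall a, (a \in J 0) = (a == 0),
        forall a, a \in J n
      & forall j, (j < n)%N ->
          [/\ {subset J j <= J j.+1}, exists2 a, a \in J j.+1 & a \notin J j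
            & exists hj : 1 \notin J j, heredity (qimage hj (J j.+1))]].

End QuasiHereditary.

(* Quivers are finite and nonempty, so that path algebras are nonzero. *)
Record quiver := Quiver {
  vert : finType;
  arr : finType;
  src : arr -> vert;
  tgt : arr -> vert;
  vert_inhabited : (0 < #|vert|)%N }.

Section Paths.
Variable Q : quiver.

Fixpoint is_walk (v : vert Q) (s : seq (arr Q)) : bool :=
  if s is a :: s' then (src a == v) && is_walk (tgt a) s' else true.

(* A path is a source vertex together with the list of arrows traversed. *)
Definition qpath := {w : vert Q * seq (arr Q) | is_walk w.1 w.2}.
HB.instance Definition _ := SubChoice.on qpath.
Implicit Types p q r : qpath.

Definition psrc p : vert Q := (val p).1.
Definition pend (v : vert Q) (s : seq (arr Q)) := last v (map (@tgt Q) s).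
Definition ptgt p : vert Q := pend (val p).1 (val p).2.

Definition ptriv (v : vert Q) : qpath := exist _ (v, [::]) isT.

Fact parr_subproof (a : arr Q) : is_walk (src a) [:: a].
Proof. by rewrite /= eqxx. Qed.
Definition parr (a : arr Q) : qpath :=
  exist _ (src a, [:: a]) (parr_subproof a).

(* Paths compose like functions: [pcomp p q] is q followed by p. *)
Definition pcomp p q : option qpath :=
  if ptgt q == psrc p then insub (psrc q, (val q).2 ++ (val p).2) else None.

Lemma is_walk_cat v s t :
  is_walk v (s ++ t) = is_walk v s && is_walk (pend v s) t.
Proof. by elim: s v => //= a s IH v; rewrite IH andbA. Qed.

Variant pcomp_spec p q : option qpath -> Type :=
| PcompSome u of ptgt q = psrc p & psrc u = psrc q & ptgt u = ptgt p
    & val u = (psrc q, (val q).2 ++ (val p).2) : pcomp_spec p q (Some u)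
| PcompNone of ptgt q != psrc p : pcomp_spec p q None.

Lemma pcompP p q : pcomp_spec p q (pcomp p q).
Proof.
rewrite /pcomp; case: eqP => [qp|/eqP]; last by constructor.
have w : is_walk (psrc q) ((val q).2 ++ (val p).2).
  by rewrite is_walk_cat (valP q) -/(ptgt q) qp (valP p).
rewrite (@insubT _ (fun w => is_walk w.1 w.2) qpath (psrc q, _) w).
constructor=> //.
by rewrite /ptgt /pend /= map_cat last_cat; congr last; exact: qp.
Qed.

Lemma pcompA p q r :
  obind (pcomp p) (pcomp q r) = obind (pcomp^~ r) (pcomp p q).
Proof.
case: (pcompP q r) => [u rq us ut uE|rq] /=;
  case: (pcompP p q) => [w qp ws wt wE|qp] //=.
- case: (pcompP p u) => [x1 _ _ _ xE|]; last by rewrite ut qp eqxx.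
  case: (pcompP w r) => [y1 _ _ _ yE|]; last by rewrite ws rq eqxx.
  by congr Some; apply: val_inj; rewrite xE yE us uE wE catA.
- by case: (pcompP p u) => // x; rewrite ut => e; rewrite e eqxx in qp.
- by case: (pcompP w r) => // x; rewrite ws => e; rewrite e eqxx in rq.
Qed.

Lemma pcomp_trivl v p :
  pcomp (ptriv v) p = if ptgt p == v then Some p else None.
Proof.
case: (pcompP (ptriv v) p) => [u -> _ _ uE|/negPf->//]; rewrite eqxx.
by congr Some; apply: val_inj; rewrite uE cats0 [RHS]surjective_pairing.
Qed.

Lemma pcomp_trivr p v :
  pcomp p (ptriv v) = if psrc p == v then Some p else None.
Proof.
case: (pcompP p (ptriv v)) => [u vp _ _ uE|vp].
  have {}vp : v = psrc p := vp.
  rewrite -vp eqxx; congr Some; apply: val_inj; rewrite uE /=.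
  by rewrite [RHS]surjective_pairing [in LHS]/psrc /= vp.
by rewrite eq_sym; case: eqP vp => // ->; rewrite eqxx.
Qed.

End Paths.

Definition biadd (V W : zmodType) (m : V -> V -> W) : Prop :=
  (forall f g h, m (f + g) h = m f h + m g h) /\
  (forall f g h, m f (g + h) = m f g + m f h).

Lemma biadd_eq (V W : zmodType) (m1 m2 : V -> V -> W) (G : V -> Prop) :
  biadd m1 -> biadd m2 ->
  (forall P : V -> Prop, P 0 -> (forall f g, P f -> P g -> P (f + g)) ->
     (forall g, G g -> P g) -> forall f, P f) ->
  (forall f g, G f -> G g -> m1 f g = m2 f g) ->
  forall f g, m1 f g = m2 f g.
Proof.
move=> b1 b2 Gind E f g.
have m0 m x : biadd m -> m 0 x = 0 :> W.
  by case=> mD _; apply: (addrI (m 0 x)); rewrite -mD !addr0.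
have mr0 m x : biadd m -> m x 0 = 0 :> W.
  by case=> _ mD; apply: (addrI (m x 0)); rewrite -mD !addr0.
elim/Gind: f => [|f1 f2 E1 E2|f Gf]; first by rewrite !m0.
  by rewrite b1.1 b2.1 E1 E2.
elim/Gind: g => [|g1 g2 E1 E2|g Gg]; first by rewrite !mr0.
  by rewrite b1.2 b2.2 E1 E2.
exact: E.
Qed.

Lemma biadd_assoc (V : zmodType) (mul : V -> V -> V) (G : V -> Prop) :
  left_distributive mul +%R -> right_distributive mul +%R ->
  (forall P : V -> Prop, P 0 -> (forall f g, P f -> P g -> P (f + g)) ->
     (forall g, G g -> P g) -> forall f, P f) ->
  (forall f g h, G f -> G g -> G h -> mul f (mul g h) = mul (mul f g) h) ->
  associative mul.
Proof.
move=> mDl mDr Gind mA f g h.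
have m0 x : mul 0 x = 0 by apply: (addrI (mul 0 x)); rewrite -mDl !addr0.
have mr0 x : mul x 0 = 0 by apply: (addrI (mul x 0)); rewrite -mDr !addr0.
elim/Gind: f => [|f1 f2 E1 E2|f Gf]; first by rewrite !m0.
  by rewrite !mDl E1 E2.
elim/Gind: g => [|g1 g2 E1 E2|g Gg]; first by rewrite !(mr0, m0).
  by rewrite !(mDl, mDr) E1 E2.
elim/Gind: h => [|h1 h2 E1 E2|h Gh]; first by rewrite !mr0.
  by rewrite !mDr E1 E2.
exact: mA.
Qed.

Section PathAlgebra.
Variables (Q : quiver) (F : fieldType).
Local Notation qpath := (qpath Q).
Implicit Types (p q r : qpath) (v : vert Q).

Definition pathalg := {malg F[qpath]}.
HB.instance Definition _ := GRing.Lmodule.on pathalg.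
Implicit Types f g h : pathalg.

Definition pU (c : F) (o : option qpath) : pathalg :=
  if o is Some p then << c *g p >> else 0.

Definition pmul f g : pathalg :=
  \sum_(p <- msupp f) \sum_(q <- msupp g) pU (f@_p * g@_q) (pcomp p q).

Definition pone : pathalg := \sum_(v : vert Q) << 1 *g ptriv v >>.

Fact pU0 o : pU 0 o = 0. Proof. by case: o => //= p; rewrite raddf0. Qed.
Fact pUD c1 c2 o : pU (c1 + c2) o = pU c1 o + pU c2 o.
Proof. by case: o => [p|] /=; rewrite ?raddfD ?addr0. Qed.

Lemma pmulw (d1 d2 : {fset qpath}) f g :
  (msupp f `<=` d1)%fset -> (msupp g `<=` d2)%fset ->
  pmul f g = \sum_(p <- d1) \sum_(q <- d2) pU (f@_p * g@_q) (pcomp p q).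
Proof.
move=> le1 le2; rewrite /pmul (big_fset_incl _ le1) /=.
  apply/eq_bigr=> p _; apply/big_fset_incl => // q _ /mcoeff_outdom ->.
  by rewrite mulr0 pU0.
move=> p _ /mcoeff_outdom fp.
by rewrite big1 => // q _; rewrite fp mul0r pU0.
Qed.

Fact pmulDl : left_distributive pmul +%R.
Proof.
move=> f g h; set d := (msupp f `|` msupp g)%fset.
have df : (msupp f `<=` d)%fset by rewrite fsubsetUl.
have dg : (msupp g `<=` d)%fset by rewrite fsubsetUr.
have dh := fsubset_refl (msupp h).
rewrite (pmulw df dh) (pmulw dg dh) (pmulw (msuppD_le f g) dh) -big_split /=.
apply: eq_bigr => p _; rewrite -big_split /=; apply: eq_bigr => q _.
by rewrite mcoeffD mulrDl pUD.
Qed.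

Fact pmulDr : right_distributive pmul +%R.
Proof.
move=> h f g; set d := (msupp f `|` msupp g)%fset.
have df : (msupp f `<=` d)%fset by rewrite fsubsetUl.
have dg : (msupp g `<=` d)%fset by rewrite fsubsetUr.
have dh := fsubset_refl (msupp h).
rewrite (pmulw dh df) (pmulw dh dg) (pmulw dh (msuppD_le f g)) -big_split /=.
apply: eq_bigr => p _; rewrite -big_split /=; apply: eq_bigr => q _.
by rewrite mcoeffD mulrDr pUD.
Qed.

Fact pmul0 f : pmul 0 f = 0.
Proof. by apply: (addrI (pmul 0 f)); rewrite -pmulDl !addr0. Qed.
Fact pmulr0 f : pmul f 0 = 0.
Proof. by apply: (addrI (pmul f 0)); rewrite -pmulDr !addr0. Qed.

Fact pmulUU c1 c2 p q :
  pmul << c1 *g p >> << c2 *g q >> = pU (c1 * c2) (pcomp p q).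
Proof.
by rewrite (pmulw msuppU_le msuppU_le) !big_seq_fset1 !mcoeffUU.
Qed.

Definition mono f : Prop := exists c p, f = << c *g p >>.

Lemma path_ind (P : pathalg -> Prop) :
  P 0 -> (forall f g, P f -> P g -> P (f + g)) ->
  (forall f, mono f -> P f) -> forall f, P f.
Proof.
move=> P0 PD PU f; rewrite (monalgE f).
by elim/big_ind: _ => // p _; apply: PU; exists f@_p, p.
Qed.

Fact pmulpU p c e o :
  pmul << c *g p >> (pU e o) = pU (c * e) (obind (pcomp p) o).
Proof. by case: o => [q|] /=; rewrite ?pmulUU ?pmulr0. Qed.
Fact pmulUp p c e o :
  pmul (pU e o) << c *g p >> = pU (e * c) (obind (@pcomp Q ^~ p) o).
Proof. by case: o => [q|] /=; rewrite ?pmulUU ?pmul0. Qed.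

Fact pmulA : associative pmul.
Proof.
apply: (biadd_assoc pmulDl pmulDr path_ind).
- move=> f g h [c [p ->]] [e [q ->]] [k [r ->]].
  apply: etrans (congr1 (pmul _) (pmulUU e k q r)) _.
  apply: etrans (pmulpU p c (e * k) (pcomp q r)) _.
  rewrite pcompA mulrA; apply: esym.
  apply: etrans (congr1 (pmul^~ _) (pmulUU c e p q)) _.
  exact: (pmulUp r k (c * e) (pcomp p q)).
Qed.

Fact pmul_suml (I : finType) (E : I -> pathalg) f :
  pmul (\sum_i E i) f = \sum_i pmul (E i) f.
Proof. by apply: (big_morph (pmul^~ f)) => [g h|]; rewrite ?pmulDl ?pmul0. Qed.
Fact pmul_sumr (I : finType) (E : I -> pathalg) f :
  pmul f (\sum_i E i) = \sum_i pmul f (E i).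
Proof. by apply: (big_morph (pmul f)) => [g h|]; rewrite ?pmulDr ?pmulr0. Qed.

Fact pmul1 : left_id pone pmul.
Proof.
move=> f; elim/path_ind: f => [|f1 f2 E1 E2|f [c [p ->]]]; first exact: pmulr0.
  by rewrite pmulDr E1 E2.
apply: etrans (pmul_suml (fun v => << 1 *g ptriv v >>) << c *g p >>) _.
under eq_bigr => v _ do rewrite pmulUU pcomp_trivl mul1r.
rewrite (bigD1 (ptgt p)) //= eqxx big1 ?addr0 // => v /negPf vp.
by rewrite eq_sym vp.
Qed.
Fact pmulr1 : right_id pone pmul.
Proof.
move=> f; elim/path_ind: f => [|f1 f2 E1 E2|f [c [p ->]]]; first exact: pmul0.
  by rewrite pmulDl E1 E2.
apply: etrans (pmul_sumr (fun v => << 1 *g ptriv v >>) << c *g p >>) _.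
under eq_bigr => v _ do rewrite pmulUU pcomp_trivr mulr1.
rewrite (bigD1 (psrc p)) //= eqxx big1 ?addr0 // => v /negPf vp.
by rewrite eq_sym vp.
Qed.

Fact ptriv_inj : injective (@ptriv Q).
Proof. by move=> v w /(congr1 (@psrc Q)). Qed.

Fact mcoeff_ptriv v w : << 1 *g ptriv w >>@_(ptriv v) = (w == v)%:R :> F.
Proof. by rewrite mcoeffU (inj_eq ptriv_inj). Qed.

Fact mcoeff_pone v : pone@_(ptriv v) = 1.
Proof.
apply: etrans (big_morph _ (mcoeffD (ptriv v)) (mcoeff0 _) _ _ _) _.
rewrite (eq_bigr _ (fun w _ => mcoeff_ptriv v w)).
by rewrite (bigD1 v) //= eqxx big1 ?addr0 // => w /negPf ->.
Qed.

Fact pone_neq0 : pone != 0.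
Proof.
have /card_gt0P[v _] := vert_inhabited Q.
apply/eqP => /(congr1 (mcoeff (ptriv v))); rewrite mcoeff_pone mcoeff0.
by move/eqP; rewrite oner_eq0.
Qed.

HB.instance Definition _ :=
  GRing.Zmodule_isNzRing.Build pathalg pmulA pmul1 pmulr1 pmulDl pmulDr
    pone_neq0.

Fact pscaleU k c p : k *: (<< c *g p >> : pathalg) = << k * c *g p >>.
Proof.
apply/malgP=> q; apply: etrans (mcoeffZ k << c *g p >> q) _.
apply: etrans (congr1 ( *%R k) (mcoeffU p c q)) _.
by apply: etrans (esym (mcoeffU p (k * c) q)); rewrite mulrnAr.
Qed.
Fact pscalepU k c o : k *: pU c o = pU (k * c) o.
Proof. by case: o => [p|] /=; rewrite ?pscaleU ?scaler0. Qed.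

Fact pscaleAl k (f g : pathalg) : k *: (f * g) = (k *: f) * g.
Proof.
pose m1 (f g : pathalg) : pathalg := k *: (f * g).
pose m2 (f g : pathalg) : pathalg := k *: f * g.
have b1 : biadd m1.
  split=> f1 f2 f3.
    exact: etrans (congr1 _ (mulrDl f1 f2 f3)) (scalerDr _ _ _).
  exact: etrans (congr1 _ (mulrDr f1 f2 f3)) (scalerDr _ _ _).
have b2 : biadd m2.
  split=> f1 f2 f3.
    exact: etrans (congr1 ( *%R ^~ f3) (scalerDr k f1 f2)) (mulrDl _ _ _).
  exact: (mulrDr (k *: f1)).
apply: (biadd_eq b1 b2 path_ind) => _ _ [c [p ->]] [e [q ->]].
apply: etrans (congr1 _ (pmulUU c e p q)) _.
apply: etrans (pscalepU _ _ _) _; rewrite mulrA.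
apply: etrans (esym (pmulUU (k * c) e p q)) _.
exact: (congr1 (fun h => pmul h << e *g q >>) (esym (pscaleU k c p))).
Qed.
HB.instance Definition _ := GRing.Lmodule_isLalgebra.Build F pathalg pscaleAl.

Fact pscaleAr k (f g : pathalg) : k *: (f * g) = f * (k *: g).
Proof.
pose m1 (f g : pathalg) : pathalg := k *: (f * g).
pose m2 (f g : pathalg) : pathalg := f * (k *: g).
have b1 : biadd m1.
  split=> f1 f2 f3.
    exact: etrans (congr1 _ (mulrDl f1 f2 f3)) (scalerDr _ _ _).
  exact: etrans (congr1 _ (mulrDr f1 f2 f3)) (scalerDr _ _ _).
have b2 : biadd m2.
  split=> f1 f2 f3; first exact: (mulrDl f1 f2).
  exact: etrans (congr1 ( *%R f1) (scalerDr k f2 f3)) (mulrDr _ _ _).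
apply: (biadd_eq b1 b2 path_ind) => _ _ [c [p ->]] [e [q ->]].
apply: etrans (congr1 ( *:%R k) (pmulUU c e p q)) _.
apply: etrans (pscalepU _ _ _) _; rewrite mulrCA.
apply: etrans (esym (pmulUU c (k * e) p q)) _.
exact: (congr1 (pmul << c *g p >>) (esym (pscaleU k e q))).
Qed.
HB.instance Definition _ := GRing.Lalgebra_isAlgebra.Build F pathalg pscaleAr.

Definition arrow (a : arr Q) : pathalg := << 1 *g parr a >>.

Fact mcoeff_trivM v (f g : pathalg) :
  (f * g)@_(ptriv v) = f@_(ptriv v) * g@_(ptriv v).
Proof.
pose m1 (f g : pathalg) : F := (f * g)@_(ptriv v).
pose m2 (f g : pathalg) : F := f@_(ptriv v) * g@_(ptriv v).
have b1 : biadd m1.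
  split=> f1 f2 f3.
    exact: etrans (congr1 _ (mulrDl f1 f2 f3)) (mcoeffD _ _ _).
  exact: etrans (congr1 _ (mulrDr f1 f2 f3)) (mcoeffD _ _ _).
have b2 : biadd m2.
  split=> f1 f2 f3; rewrite /m2.
    by rewrite (mcoeffD _ f1 f2) mulrDl.
  by rewrite (mcoeffD _ f2 f3) mulrDr.
apply: (biadd_eq b1 b2 path_ind) => _ _ [c [p ->]] [e [q ->]].
apply: etrans (congr1 (mcoeff (ptriv v)) (pmulUU c e p q)) _.
apply: etrans _ (esym (f_equal2 *%R (mcoeffU p c _) (mcoeffU q e _))).
case: (pcompP p q) => [u qp us ut uE|qp] /=; last first.
  rewrite mcoeff0; case: eqP => [pv|_]; last by rewrite mulr0n mul0r.
  case: eqP => [qv|_]; last by rewrite mulr0n mulr0.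
  by rewrite pv qv eqxx in qp.
rewrite (mcoeffU u) -!val_eqE uE /= /psrc.
case: p q qp {us ut uE} => [[a s] sw] [[b t] tw].
rewrite /ptgt /psrc /= !xpair_eqE => qp.
case: t {tw} qp => [|y t] /=; last by rewrite !andbF !mulr0n mulr0.
move=> <-; case: eqP => _ /=; case: s {sw} => [|z s] /=;
  by rewrite ?mulr0n ?mulr0 ?mul0r ?mulr1n.
Qed.

End PathAlgebra.

Section Lambda.
Variables (F : fieldType) (r : nat).

(* The vertex i with 1 <= i <= r is [lift ord0 i'], i' : 'I_r; the arrow
   alpha_i : i -> 0 is [inl i'] and beta_i : 0 -> i is [inr i']. *)
Definition lambda_src (a : 'I_r + 'I_r) : 'I_r.+1 :=
  match a with inl i => lift ord0 i | inr _ => ord0 end.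
Definition lambda_tgt (a : 'I_r + 'I_r) : 'I_r.+1 :=
  match a with inl _ => ord0 | inr i => lift ord0 i end.

Fact lambda_inhabited : (0 < #|'I_r.+1|)%N. Proof. by rewrite card_ord. Qed.

Definition lambda_quiver : quiver :=
  Quiver lambda_src lambda_tgt lambda_inhabited.

Definition alpha (i : 'I_r) : pathalg lambda_quiver F :=
  arrow F (inl i : arr lambda_quiver).
Definition beta (i : 'I_r) : pathalg lambda_quiver F :=
  arrow F (inr i : arr lambda_quiver).

Definition lambda_relation (f : pathalg lambda_quiver F) : Prop :=
  exists i : 'I_r, f = alpha i * beta i.

Definition lambda_ideal : ideal (pathalg lambda_quiver F) :=
  gen_ideal lambda_relation.

Definition no_triv0 : {pred pathalg lambda_quiver F} :=
  fun f => f@_(ptriv (ord0 : vert lambda_quiver)) == 0.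

Fact no_triv0_zmod : zmod_closed no_triv0.
Proof.
split=> [|f g /eqP f0 /eqP g0]; first by rewrite unfold_in mcoeff0.
by rewrite unfold_in mcoeffB f0 g0 subr0.
Qed.
Fact no_triv0_mull f g : g \in no_triv0 -> f * g \in no_triv0.
Proof. by rewrite !unfold_in mcoeff_trivM => /eqP ->; rewrite mulr0. Qed.
Fact no_triv0_mulr f g : g \in no_triv0 -> g * f \in no_triv0.
Proof. by rewrite !unfold_in mcoeff_trivM => /eqP ->; rewrite mul0r. Qed.

Lemma lambda_ideal_proper : 1 \notin lambda_ideal.
Proof.
apply/negP => /asboolP /(_ (Ideal no_triv0_zmod no_triv0_mull no_triv0_mulr)).
suff rel f : lambda_relation f -> f \in no_triv0.
  move/(_ rel)/eqP => one0; move/eqP: (oner_neq0 F); apply.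
  exact: etrans (esym (mcoeff_pone F (ord0 : vert lambda_quiver))) one0.
case=> i ->; apply/eqP; apply: etrans (mcoeff_trivM _ _ _) _.
apply: etrans (congr1 ( *%R^~ _) (mcoeffU _ 1 _)) _.
by case: eqP => [/(congr1 val)//|_]; rewrite mulr0n mul0r.
Qed.

Definition Lambda : algType F := qalg lambda_ideal_proper.

End Lambda.

(* Main.v *)
Require Import Defs.
From HB Require Import structures.
From mathcomp Require Import all_boot all_order all_algebra all_field.
From mathcomp Require Import boolp finmap monalg ring.

(** The sets xR_i, of one or two points each, cut every matrix over X into
    blocks.  Since the valencies are at most 2, regularity leaves two
    possibilities for a block (i, j): either one relation contains all pairs in
    xR_i x xR_j, or both sets have two points and two relations cut the block
    into its two perfect matchings ([block_cases]).  Name the points of every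
    xR_i.  The Terwilliger algebra T then has as basis the all-ones blocks
    J_ij, for all i and j, together with the blocks D_ij that match first
    points with first points and second points with second points, for i ~ j:
    a matching D_ij is obtained by composing matchings along a chain of blocks
    of the second kind, and ~ is connectedness by such chains, because a bad
    pair is a chain of good pairs ([simP]).  The multiplication is
      J_ij J_jl = k_j J_il,   D_ij J_jl = J_il = J_ij D_jl,   D_ij D_jl = D_il,
    all other products of basis elements being 0, in every characteristic
    ([terwilliger_coords]).  The rest of the proof uses only this description.

    The basis is cellular for the transpose: the J_ij form the lowest cell and
    the D_ij of one class of ~ form a cell each ([cells_cellular]).  Adding one
    cell after the other gives the chain of ideals required of a
    quasi-hereditary algebra ([coords_quasi_hereditary]).  The lowest ideal is
    generated by the idempotent J_00, because k_0 = 1 gives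
    J_ij = J_i0 J_0j; modulo the ideals below it, every further cell is a full
    matrix algebra.

    In characteristic 2 the product J_ij J_jl vanishes as soon as k_j = 2.
    Hence the J_ij with k_i and k_j not both equal to 1 span a nilpotent left
    ideal N.  Put e_0 = J_00, and e_v = D_cc for a representative c of the class
    number v.  These idempotents are local modulo N, pairwise inequivalent, and
    detect every element outside N, so that the T e_v are the indecomposable
    projective modules ([principal_complete], [vertex_complete]).  The direct
    sum of these modules is T e, where e is the sum of the e_v, and its
    endomorphism algebra is opposite to e T e ([end_alg_iso_corner]).  A basis
    of e T e consists of the e_v and of the J_cc' between representatives other
    than J_00 = e_0.  Here J_c0 and J_0c are the arrows,
    J_c0 J_0c' = J_cc', while J_0c J_c0 = 2 J_00 = 0 is the relation; a path
    that avoids 0 -> i -> 0 has length at most 2, so that no basis element is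
    missing or repeated ([path_classify], [path_ev_ker], [path_ev_surj]). *)

Set Implicit Arguments.
Unset Strict Implicit.
Unset Printing Implicit Defensive.

Import GRing.Theory.
Local Open Scope ring_scope.

(** * Heredity ideals in a quotient algebra *)

Definition mklin (B : pzRingType) (M N : lmodType B) (f : M -> N)
    (lin_f : linear f) : {linear M -> N} :=
  HB.pack f (GRing.isLinear.Build B M N *:%R f lin_f).

(** A lifting of f along g sends p to the sum of the phi_k(p) m_k, where m_k
    is any preimage of f (r_k). *)
Lemma projective_dual_basis (B : pzRingType) (P : lmodType B) (K : finType)
    (r : K -> P) (phi : K -> {linear P -> B^o}) :
  (forall p, p = \sum_k (phi k p : B) *: r k) -> projective P.
Proof.
move=> phiK M N g f g_surj.
have [m gm] : exists m : K -> M, forall k, g (m k) = f (r k).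
  by exists (fun k => projT1 (cid (g_surj (f (r k))))) => k; case: cid.
have lin_h : linear (fun p => \sum_k (phi k p : B) *: m k).
  move=> a u v; rewrite scaler_sumr -big_split /=; apply: eq_bigr => k _.
  by rewrite linearP scalerDl scalerA.
exists (mklin lin_h) => p /=; rewrite raddf_sum [p in RHS]phiK raddf_sum /=.
by apply: eq_bigr => k _; rewrite !linearZ /= gm.
Qed.

Section Heredity.
Variables (F : fieldType) (A : algType F).
Implicit Types (I J : ideal A) (a b u v w : A).

(** The elements w with J w v = 0 form a left ideal. The hypothesis says that
    J only fails to kill generators of the module A v, so this left ideal is
    maximal or everything, and it contains the Jacobson radical. *)
Lemma jacobson_annihilates J v :
  (forall u w, u \in J -> u * w * v != 0 -> exists b, b * w * v = v) ->
  forall u a, u \in J -> jacobson a -> u * a * v = 0.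
Proof.
move=> gen_v u a uJ rad_a; apply/eqP/negPn/negP => uav.
pose M : {pred A^o} := fun w => `[< forall u, u \in J -> u * w * v = 0 >].
have MP (w : A) : reflect (forall u, u \in J -> u * w * v = 0) (w \in M).
  exact: asboolP.
(* The radical element a lies in M, contradicting u a v <> 0. *)
suff /rad_a/MP/(_ u uJ)/eqP : max_left_ideal M by apply/negP.
split.
- split=> [|b w1 w2 /MP w1M /MP w2M]; apply/MP => z zJ.
    by rewrite mulr0 mul0r.
  by rewrite mulrDr mulrDl mulrA w1M ?ideal_mulr // w2M // addr0.
- apply: contra uav => /MP M1.
  by rewrite -[u * a]mulr1 M1 // ideal_mulr.
- move=> N [N0 Nlin] N1 sMN w wN; apply/MP => z zJ.
  apply/eqP/negPn/negP => zwv; have [b bwv] := gen_v _ _ zJ zwv.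
  have M1 : 1 - b * w \in M.
    by apply/MP=> y yJ; rewrite mulrBr mulrBl mulr1 -mulrA bwv subrr.
  case/negP: N1; have := Nlin b w (1 - b * w) wN (sMN _ M1).
  by rewrite [X in X + _]/(b * w) addrC subrK.
Qed.

End Heredity.

Section Quotient.
Variables (F : fieldType) (A : algType F).
Implicit Types (a b u v w : A).
Variables (I J : ideal A) (sIJ : {subset I <= J}) (I1 : 1 \notin I).

Lemma mem_qimage a : (qpi I1 a \in qimage I1 J) = (a \in J).
Proof.
apply/asboolP/idP => [[b bJ /eqP]|aJ]; last by exists a.
by rewrite qpi_eq => /sIJ abJ; rewrite -(subrK b a) rpredD.
Qed.

Lemma qpi_eq0 a : (qpi I1 a == 0) = (a \in I).
Proof. by rewrite -(raddf0 (qpi I1)) qpi_eq subr0. Qed.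

Lemma qpiM3 a b c : qpi I1 a * qpi I1 b * qpi I1 c = qpi I1 (a * b * c).
Proof. exact: etrans (congr1 ( *%R^~ _) (qpiM I1 a b)) (qpiM I1 _ c). Qed.

Lemma ZqpiE a b : qpi I1 a *: (qpi I1 b : (qalg I1)^o) = qpi I1 (a * b).
Proof. exact: qpiM. Qed.

(** All hypotheses live in A and hold modulo I, so that this criterion can be
    applied without computing in A / I. The r_k and phi_k are a dual basis of
    J / I as a left module; the phi_k take values in J, so that the same
    expansion shows that J / I is idempotent. The elements of G span J / I,
    and each is recovered from any of its multiples that J does not kill,
    which is the form of simplicity used by [jacobson_annihilates]. *)
Lemma heredity_quotient (K : finType) (r : K -> A)
    (phi : K -> {additive A -> A}) (G : A -> Prop) :
    (forall k, r k \in J) ->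
    (forall k u, u \in J -> phi k u \in J) ->
    (forall k u, u \in I -> phi k u \in I) ->
    (forall k a u, u \in J -> phi k (a * u) - a * phi k u \in I) ->
    (forall u, u \in J -> u - \sum_k phi k u * r k \in I) ->
    (forall u, u \in J -> exists s : seq A,
       (forall g, g \in s -> G g) /\ u - \sum_(g <- s) g \in I) ->
    (forall v u w, G v -> u \in J -> u * w * v \notin I ->
       exists b, b * w * v - v \in I) ->
  heredity (qimage I1 J).
Proof.
move=> rJ phiJ phiI phiM phiK span_G gen_G.
have qphi k a : qpi I1 (phi k (repr (qpi I1 a))) = qpi I1 (phi k a).
  by apply/eqP; rewrite qpi_eq -raddfB phiI // -(qpi_eq I1) /qpi reprK.
have qphiK u : u \in J -> qpi I1 u = \sum_k qpi I1 (phi k u) * qpi I1 (r k).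
  move=> uJ; apply/eqP; rewrite -subr_eq0; have := phiK u uJ.
  rewrite -qpi_eq0 raddfB raddf_sum /=.
  by under eq_bigr do rewrite -qpiM.
split.
- move=> q; elim/(@qind _ _ I I1): q => u; rewrite mem_qimage => uJ.
  exists [seq (qpi I1 (phi k u), qpi I1 (r k)) | k : K]; split=> [w|].
    by case/mapP=> k _ -> /=; rewrite !mem_qimage phiJ ?rJ.
  by rewrite big_map big_enum /= qphiK.
- move=> q a q'; elim/(@qind _ _ I I1): q => u; elim/(@qind _ _ I I1): q' => v.
  rewrite [qpi I1 u \in _]mem_qimage [qpi I1 v \in _]mem_qimage => uJ rad_a vJ.
  have [s [sG vs]] := span_G v vJ.
  have -> : qpi I1 v = \sum_(g <- s) qpi I1 g.
    by apply/eqP; rewrite -subr_eq0; move: vs; rewrite -qpi_eq0 raddfB raddf_sum.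
  rewrite mulr_sumr big_seq big1 // => g /sG Gg.
  apply: (@jacobson_annihilates _ _ (qimage I1 J)) => //; last first.
    by rewrite mem_qimage.
  move=> x y; elim/(@qind _ _ I I1): x => x; elim/(@qind _ _ I I1): y => y.
  rewrite mem_qimage qpiM3 qpi_eq0 => xJ xyI.
  have [b bI] := gen_G _ _ _ Gg xJ xyI.
  by exists (qpi I1 b); apply/eqP; rewrite qpiM3 qpi_eq.
- pose P := ideal_lmod (qimage I1 J).
  have rJ' k : (qpi I1 (r k) : (qalg I1)^o) \in regular_pred (qimage I1 J).
    by rewrite [_ \in _]mem_qimage.
  pose r' k : P := exist _ (qpi I1 (r k)) (rJ' k).
  have phi_lin k : linear (fun q : P => qpi I1 (phi k (repr (val q))) : (qalg I1)^o).
    move=> a [u uJ] [v vJ] /=.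
    elim/(@qind _ _ I I1): a uJ vJ => a.
    elim/(@qind _ _ I I1): u => u; elim/(@qind _ _ I I1): v => v uJ vJ.
    have {}uJ : u \in J by rewrite -mem_qimage.
    have -> : qpi I1 a *: (qpi I1 u : (qalg I1)^o) + qpi I1 v = qpi I1 (a * u + v).
      by rewrite raddfD /= ZqpiE.
    rewrite !qphi; apply/eqP; rewrite ZqpiE -raddfD qpi_eq.
    by rewrite (raddfD (phi k)) opprD addrACA subrr addr0 phiM.
  apply: (@projective_dual_basis _ P K r' (fun k => mklin (phi_lin k))).
  case=> q; elim/(@qind _ _ I I1): q => u uJ.
  apply: val_inj; rewrite raddf_sum /=.
  have {}uJ : u \in J by rewrite -mem_qimage.
  apply: etrans (qphiK u uJ) _.
  by apply: eq_bigr => k _; rewrite -(qphi k u).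
Qed.

End Quotient.

(** * Indecomposable projective modules over an algebra with local idempotents *)

Section PrincipalModule.
Variables (B : nzRingType) (e : B).

(** For an idempotent e this is the left ideal B e; as the solution set of an
    equation it needs no choice of a factor. *)
Definition fixr : {pred B^o} := fun w : B => w * e == w.

Lemma fixrP (w : B) : reflect (w * e = w) (w \in fixr).
Proof. exact: eqP. Qed.

Fact fixr_submod : submod_closed fixr.
Proof.
split=> [|a u v /fixrP ue /fixrP ve]; apply/fixrP; first exact: mul0r.
by rewrite mulrDl ve -[_ * e]mulrA ue.
Qed.
HB.instance Definition _ := GRing.isSubmodClosed.Build B B^o fixr fixr_submod.

Definition principal : lmodType B := submodule fixr.

Definition to_principal w (we : w * e = w) : principal :=
  exist _ (w : B^o) (introT (fixrP w) we).

Lemma principalK (u : principal) : (val u : B) * e = val u.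
Proof. exact/fixrP/(valP u). Qed.

Lemma principal_projective : e * e = e -> projective principal.
Proof.
move=> ee; have lin : linear (fun u : principal => val u : B^o).
  by move=> a u v.
apply: (@projective_dual_basis _ _ unit (fun _ => to_principal ee)
          (fun _ => mklin lin)) => u.
rewrite (bigD1 tt) //= big1 ?addr0 => [|[]//].
by apply: val_inj => /=; rewrite -[LHS]principalK.
Qed.

End PrincipalModule.

Section FreeModule.
Variables (B : nzRingType) (Q : lmodType B) (X : choiceType) (h : X -> Q).

Lemma malg_ev_linear :
  linear (fun f : {malg B[X]} => \sum_(q <- msupp f) f@_q *: h q).
Proof.
have evw (d : {fset X}) (f : {malg B[X]}) : (msupp f `<=` d)%fset ->
    \sum_(q <- msupp f) f@_q *: h q = \sum_(q <- d) f@_q *: h q.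
  move=> sfd; apply: big_fset_incl => // q _ /mcoeff_outdom ->.
  by rewrite scale0r.
move=> a f g; set d := (msupp f `|` msupp g)%fset.
rewrite (evw d f) ?fsubsetUl // (evw d g) ?fsubsetUr //.
rewrite (evw d (a *: f + g)); last first.
  exact: fsubset_trans (msuppD_le _ _) (fsetSU _ (msuppZ_le _ _)).
rewrite scaler_sumr -big_split /=; apply: eq_bigr => q _.
by rewrite mcoeffD mcoeffZ scalerDl scalerA.
Qed.

Definition malg_ev : {linear {malg B[X]} -> Q} := mklin malg_ev_linear.

Lemma malg_evU c k : malg_ev << c *g k >> = c *: h k.
Proof.
rewrite /= (big_fset_incl _ msuppU_le) /=.
  by rewrite big_seq_fset1 mcoeffUU.
by move=> x _ /mcoeff_outdom ->; rewrite scale0r.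
Qed.

End FreeModule.

(** Q is a quotient of the free module on the set Q, and a section of the
    quotient map has coordinates. The module Q need not be finitely generated,
    but each of its elements involves finitely many coordinates. *)
Lemma projective_dual_basis_exists (B : nzRingType) (Q : lmodType B) : projective Q ->
  exists phi : Q -> {linear Q -> B^o}, forall v : Q, exists s : seq Q,
    v = \sum_(q <- s) (phi q v : B) *: q.
Proof.
pose ev := malg_ev (id : Q -> Q) => /(_ _ _ ev (idfun : {linear Q -> Q})).
case=> [q|h hK].
  by exists << 1 *g q >>; rewrite malg_evU scale1r.
have lin q : linear (fun v => (h v)@_q : B^o).
  by move=> a u v; rewrite linearP mcoeffD mcoeffZ.
exists (fun q => mklin (lin q)) => v; exists (msupp (h v)).
by rewrite -[LHS]hK.
Qed.

Section LocalIdempotents.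
Variables (B : nzRingType) (m : nat) (e : 'I_m -> B) (N : {pred B}).
Hypothesis N0 : 0 \in N.
Hypothesis ND : forall u v, u \in N -> v \in N -> u + v \in N.
Hypothesis NMl : forall a u, u \in N -> a * u \in N.
Hypothesis Nnil : forall u v w, u \in N -> v \in N -> w \in N -> u * v * w = 0.
Hypothesis e_idem : forall i, e i * e i = e i.
Hypothesis eN : forall i, e i \notin N.
Hypothesis e_local :
  forall i w, w * e i = w -> w \notin N -> exists b, b * w = e i.
Hypothesis e_neq : forall i j a, i != j -> e i * a * e j \in N.
Hypothesis e_cover : forall a, a \notin N -> exists c i, a * c * e i \notin N.

(** Of the two components of e_i in a decomposition of B e_i, one lies outside
    N and therefore generates B e_i. *)
Lemma principal_indecomposable i : indecomposable (principal (e i)).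
Proof.
pose ei := to_principal (e_idem i).
have ei0 : ei != 0.
  by apply/eqP => /(congr1 val) /= e0; have := eN i; rewrite e0 N0.
split; first by exists ei.
have full U : submod_closed U -> forall u : principal (e i), u \in U ->
    (val u : B) \notin N -> forall v, v \in U.
  move=> [U0 UD] u uU uN v; have [b bu] := e_local (principalK u) uN.
  have := UD (val v * b) u 0 uU U0; rewrite addr0.
  suff -> : (val v * b) *: u = v by [].
  apply: val_inj; apply: etrans (esym (mulrA (val v : B) b _)) _.
  exact: etrans (congr1 _ bu) (principalK v).
move=> U V sU sV sum_UV cap_UV.
have [u [v [uU vV eiE]]] := sum_UV ei.
have [uN|uN] := boolP ((val u : B) \in N); last first.
  by right=> y yV; apply: cap_UV => //; exact: full sU u uU uN y.
left=> y yU; apply: cap_UV => //; apply: (full V sV v vV).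
apply: contra (eN i) => vN; have := congr1 val eiE; rewrite /= => ->.
exact: ND.
Qed.

(** A homomorphism from B e_i to B e_j sends e_i to an element of e_i B e_j,
    hence has its image in N. *)
Lemma principal_not_iso i j : i != j -> ~ lmod_iso (principal (e i)) (principal (e j)).
Proof.
move=> ij [f [g fK gK]]; pose ei := to_principal (e_idem i).
pose ej := to_principal (e_idem j).
have fei : (val (f ei) : B) \in N.
  have eiei : (e i) *: ei = ei by apply: val_inj; exact: e_idem.
  rewrite -eiei linearZ /= -(principalK (f ei)).
  by rewrite [_ *: _]mulrA e_neq.
case/negP: (eN j).
have ejE : ej = f (val (g ej) *: ei).
  rewrite -[LHS]gK; congr (f _); apply: val_inj.
  exact: (esym (principalK (g ej))).
have -> : e j = (val (g ej) : B) * val (f ei).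
  by have := congr1 val ejE; rewrite linearZ.
exact: NMl.
Qed.

(** Some coordinate of Q takes a value outside N, since otherwise Q = N Q = N
    N N Q = 0. Followed by a right multiplication, this coordinate becomes a
    map from Q to B e_i whose image contains e_i. Such a map splits. *)
Lemma proj_indec_principal (Q : lmodType B) :
  projective Q -> indecomposable Q -> exists i, lmod_iso Q (principal (e i)).
Proof.
move=> /projective_dual_basis_exists[phi phiK] [[v0 v0n0] indecQ].
have [q [v phiN]] : exists q v, (phi q v : B) \notin N.
  apply: contrapT => noN; case/eqP: v0n0.
  have phiN q v : (phi q v : B) \in N.
    by apply: contrapT => /negP qvN; apply: noN; exists q, v.
  have kill2 x y (v : Q) : x \in N -> y \in N -> (x * y) *: v = 0.
    move=> xN yN; have [s ->] := phiK v.
    by rewrite scaler_sumr big1 // => w _; rewrite scalerA Nnil ?scale0r.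
  have kill1 x (v : Q) : x \in N -> x *: v = 0.
    move=> xN; have [s ->] := phiK v.
    by rewrite scaler_sumr big1 // => w _; rewrite scalerA kill2.
  by have [s ->] := phiK v0; rewrite big1 // => w _; rewrite kill1.
have [c [i avN]] := e_cover phiN; exists i.
have th_e x : (phi q x : B) * c * e i * e i = (phi q x : B) * c * e i.
  by rewrite -mulrA e_idem.
have lin_th : linear (fun x => to_principal (th_e x)).
  move=> a x y; apply: val_inj => /=.
  by rewrite linearP /= !mulrDl -!mulrA; congr (_ + _).
pose th := mklin lin_th; pose ei := to_principal (e_idem i).
have [b bth] := e_local (th_e v) avN.
pose v1 := b *: v.
have th1 : th v1 = ei.
  by rewrite linearZ; apply: val_inj; exact: bth.
have lin_s : linear (fun w : principal (e i) => (val w : B) *: v1).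
  move=> a x y; apply: etrans (scalerDl v1 (a * (val x : B)) (val y : B)) _.
  by rewrite -scalerA.
pose s := mklin lin_s.
have thK w : th (s w) = w.
  by rewrite linearZ th1; apply: val_inj; exact: (principalK w).
pose U : {pred Q} := fun x => s (th x) == x.
pose V : {pred Q} := fun x => th x == 0.
have UP (x : Q) : reflect (s (th x) = x) (x \in U) by exact: eqP.
have VP (x : Q) : reflect (th x = 0) (x \in V) by exact: eqP.
have sU : submod_closed U.
  split=> [|a x y /UP xU /UP yU]; apply/UP; first by rewrite !linear0.
  by rewrite !linearP xU yU.
have sV : submod_closed V.
  split=> [|a x y /VP xV /VP yV]; apply/VP; first by rewrite linear0.
  by rewrite linearP xV yV scaler0 addr0.
have VB x : x - s (th x) \in V by apply/VP; rewrite linearB thK subrr.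
have sum_UV x : exists y z, [/\ y \in U, z \in V & x = y + z].
  exists (s (th x)), (x - s (th x)); rewrite VB addrC subrK; split=> //.
  by apply/UP; rewrite thK.
have cap_UV x : x \in U -> x \in V -> x = 0.
  by move=> /UP xU /VP xV; rewrite -xU xV linear0.
have [U0|V0] := indecQ U V sU sV sum_UV cap_UV; last first.
  exists th; exists s => // x; apply/esym/eqP; rewrite -subr_eq0; exact/eqP/V0.
have : s ei = 0 by apply: U0; apply/UP; rewrite thK.
move/(congr1 th); rewrite thK linear0 => /(congr1 val) /= e0.
by have := eN i; rewrite e0 N0.
Qed.

(** N plays the part of the radical: it is a nilpotent left ideal, the e_i are
    local and pairwise inequivalent modulo N, and every element outside N
    stays outside after a passage to some B e_i. *)
Lemma principal_complete : complete_proj_indec (fun i => principal (e i)).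
Proof.
split=> [i|i j|Q]; last exact: proj_indec_principal.
  by split; [exact: principal_projective | exact: principal_indecomposable].
exact: principal_not_iso.
Qed.

End LocalIdempotents.

Section CompleteUnique.
Variables (B : nzRingType) (m n : nat) (e : 'I_m -> B) (P : 'I_n -> lmodType B).
Hypothesis e_idem : forall i, e i * e i = e i.
Hypothesis e_orth : forall i j, i != j -> e i * e j = 0.
Hypothesis e_complete : complete_proj_indec (fun i => principal (e i)).
Hypothesis P_complete : complete_proj_indec P.

Lemma lmod_iso_trans (M1 M2 M3 : lmodType B) :
  lmod_iso M1 M2 -> lmod_iso M2 M3 -> lmod_iso M1 M3.
Proof.
case=> f bij_f [g bij_g]; have lin : linear (g \o f).
  by move=> a x y; rewrite /= !linearP.
by exists (mklin lin); exact: bij_comp.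
Qed.

(** Two complete lists of indecomposable projective modules agree up to order
    and isomorphism, and the direct sum of the B e_i is B e for the sum e of
    the orthogonal idempotents e_i. *)
Lemma dirsum_principal :
  exists f : {linear dirsum P -> B^o}, injective f /\
    forall w : B, (exists v, f v = w) <-> w * \sum_i e i = w.
Proof.
have [Pproj Pneq Pall] := P_complete; have [eproj eneq eall] := e_complete.
have [s sP] : exists s : 'I_n -> 'I_m,
    forall i, lmod_iso (P i) (principal (e (s i))).
  exists (fun i => projT1 (cid (eall _ (Pproj i).1 (Pproj i).2))) => i.
  by case: cid.
have [t tP] : exists t : 'I_m -> 'I_n,
    forall j, lmod_iso (principal (e j)) (P (t j)).
  exists (fun j => projT1 (cid (Pall _ (eproj j).1 (eproj j).2))) => j.
  by case: cid.
have tK : cancel t s.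
  move=> j; apply: contrapT => /eqP; rewrite eq_sym => /eneq; apply.
  exact: lmod_iso_trans (tP j) (sP (t j)).
have sK : cancel s t.
  move=> i; apply: contrapT => /eqP; rewrite eq_sym => /Pneq; apply.
  exact: lmod_iso_trans (sP i) (tP (s i)).
pose g i : {linear P i -> principal (e (s i))} := projT1 (cid (sP i)).
have g_bij i : bijective (g i) by rewrite /g; case: cid.
have g_surj i (w : B) : exists v : P i, val (g i v) = w * e (s i).
  have we : w * e (s i) * e (s i) = w * e (s i) by rewrite -mulrA e_idem.
  have [g' gK g'K] := g_bij i; exists (g' (to_principal we)).
  by rewrite g'K.
have lin_f : linear (fun v : dirsum P => \sum_i val (g i (v i)) : B^o).
  move=> a u v; rewrite scaler_sumr -big_split /=; apply: eq_bigr => i _.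
  by rewrite !ffunE linearP.
pose f := mklin lin_f.
have fE v : (f v : B) = \sum_i (val (g i (v i)) : B) by [].
have f_e v i : (f v : B) * e (s i) = val (g i (v i)).
  rewrite fE mulr_suml (bigD1 i) //= big1 ?addr0 => [|k ki].
    exact: principalK.
  rewrite -(principalK (g k (v k))) -mulrA e_orth ?mulr0 //.
  by rewrite (can_eq sK).
have sum_s (w : B) : w * \sum_i e i = \sum_i w * e (s i).
  by rewrite mulr_sumr (reindex s) //; exists t => ? _; rewrite ?sK ?tK.
exists f; split=> [u v uv|w].
  apply/ffunP=> i; apply: (bij_inj (g_bij i)); apply: val_inj.
  by rewrite -!f_e uv.
rewrite sum_s; split=> [[v <-]|wE].
  by rewrite [RHS]fE; apply: eq_bigr => i _; rewrite f_e.
have v_ex i := cid (g_surj i w).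
exists [ffun i => projT1 (v_ex i)]; rewrite -[RHS]wE.
by apply: eq_bigr => i _; rewrite ffunE; case: (v_ex i).
Qed.

End CompleteUnique.

(** Endomorphisms of A e are the right multiplications by elements of e A e.
    They compose in the opposite order, which is why mu reverses products. *)
Lemma end_alg_iso_corner (F : fieldType) (A L : algType F) (M : lmodType A)
    (f : {linear M -> A^o}) (e : A) (I : ideal L) (I1 : 1 \notin I)
    (mu : {linear L -> A}) :
    injective f -> e * e = e ->
    (forall w : A, (exists v, f v = w) <-> w * e = w) ->
    mu 1 = e -> (forall a b, mu (a * b) = mu b * mu a) ->
    (forall a, (a \in I) = (mu a == 0)) ->
    (forall w, e * w * e = w -> exists a, mu a = w) ->
  end_alg_iso M (qalg I1).
Proof.
move=> f_inj ee f_im mu1 muM muI mu_surj.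
pose nu (q : qalg I1) := mu (repr q).
have nuE a : nu (qpi I1 a) = mu a.
  by apply/eqP; rewrite -subr_eq0 -raddfB -muI -(qpi_eq I1) /qpi reprK.
have nue q : nu q * e = nu q by rewrite -mu1 -muM mul1r.
have enu q : e * nu q = nu q by rewrite -mu1 -muM mulr1.
have fe v : (f v : A) * e = f v by apply/f_im; exists v.
have act_ex q v : exists v', f v' = (f v : A) * nu q.
  by apply/f_im; rewrite -mulrA nue.
pose act q v := projT1 (cid (act_ex q v)).
have actE q v : f (act q v) = (f v : A) * nu q by rewrite /act; case: cid.
have lin_act q : linear (act q).
  move=> a u v; apply: f_inj; rewrite actE !linearP !actE mulrDl.
  by rewrite [a *: f u]/(a * _) -mulrA.
have [ve feE] : exists v, f v = e by apply/f_im.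
exists (fun q => mklin (lin_act q)); split=> [k a b v|v|a b v|a b ab|h] /=.
- apply: f_inj; rewrite linearP !actE.
  elim/(@qind _ _ I I1): a => a; elim/(@qind _ _ I I1): b => b.
  have -> : k *: qpi I1 a + qpi I1 b = qpi I1 (k *: a + b).
    by rewrite raddfD; congr (_ + _); exact: qpiZ.
  rewrite !nuE linearP mulrDr; congr (_ + _).
  by rewrite [RHS](mulr_algl k) scalerAr.
- by apply: f_inj; rewrite actE [1]/(qpi I1 1) nuE mu1 fe.
- apply: f_inj; rewrite !actE -mulrA; congr (_ * _).
  elim/(@qind _ _ I I1): a => a; elim/(@qind _ _ I I1): b => b.
  by rewrite [_ * _ in LHS]qpiM !nuE muM.
- have /(congr1 f) := ab ve; rewrite !actE feE !enu.
  elim/(@qind _ _ I I1): a {ab} => a; elim/(@qind _ _ I I1): b => b.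
  by rewrite !nuE => ab; apply/eqP; rewrite qpi_eq muI linearB ab subrr.
- have evE v : (f v : A) *: ve = v.
    by apply: f_inj; rewrite linearZ /= feE; exact: fe.
  have fhE v : (f (h v) : A) = (f v : A) * f (h ve).
    by rewrite -{1}[v]evE !linearZ.
  have [] := mu_surj (f (h ve)) => [|a aE].
    by rewrite -[in LHS]feE -fhE feE fe.
  by exists (qpi I1 a) => v; apply: f_inj; rewrite actE nuE aE -fhE.
Qed.

(** * The algebra of all-ones blocks and matching blocks *)

Section PairCoordinates.
Variables (F : fieldType) (n r : nat) (cl : 'I_n -> 'I_r.+1).

(** The label 0 marks the indices of one-point blocks; the indices of
    two-point blocks are labelled by their class. *)
Definition linked (i j : 'I_n) : bool := (cl i == cl j) && (cl i != ord0).

Lemma linkedE i j : linked i j = (cl i == cl j) && (cl i != ord0).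
Proof. by []. Qed.

Definition linked_mx (g : 'M[F]_n) : Prop :=
  forall i j, ~~ linked i j -> g i j = 0.

(** The diagonal matrix of the block sizes, which enter the product of two
    all-ones blocks. *)
Definition size_mx : 'M[F]_n :=
  diag_mx (\row_i (if cl i == ord0 then 1 else 2%:R)).

(** Coordinates on an algebra with a basis of elements J_ij, for all i and j,
    and D_ij, for linked i and j, whose products are J_ij J_jl = k_j J_il,
    D_ij J_jl = J_il = J_ij D_jl and D_ij D_jl = D_il. The coefficients of the
    J_ij form the matrix [ones_part], those of the D_ij the matrix
    [match_part]. *)
Record pair_coords (A : falgType F) := PairCoords {
  ones_part : {linear A -> 'M[F]_n};
  match_part : {linear A -> 'M[F]_n};
  of_parts : 'M[F]_n -> 'M[F]_n -> A;
  match_part_linked : forall u, linked_mx (match_part u);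
  ones_part_of : forall f g, linked_mx g -> ones_part (of_parts f g) = f;
  match_part_of : forall f g, linked_mx g -> match_part (of_parts f g) = g;
  of_partsK : forall u, of_parts (ones_part u) (match_part u) = u;
  match_partM : forall u v, match_part (u * v) = match_part u *m match_part v;
  ones_partM : forall u v, ones_part (u * v)
    = ones_part u *m size_mx *m ones_part v
      + match_part u *m ones_part v + ones_part u *m match_part v }.

End PairCoordinates.

Lemma delta_mulE (F : fieldType) n (i j a b : 'I_n) (M : 'M[F]_n) :
  (delta_mx i j *m M) a b = (a == i)%:R * M j b.
Proof.
rewrite mxE (bigD1 j) //= mxE eqxx andbT big1 ?addr0 // => k kj.
by rewrite mxE (negPf kj) andbF mul0r.
Qed.

Lemma mul_deltaE (F : fieldType) n (i j a b : 'I_n) (M : 'M[F]_n) :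
  (M *m delta_mx i j) a b = M a i * (b == j)%:R.
Proof.
rewrite mxE (bigD1 i) //= mxE eqxx big1 ?addr0 // => k ki.
by rewrite mxE (negPf ki) mulr0.
Qed.

Lemma delta_mul_delta (F : fieldType) n (i j k l : 'I_n) (M : 'M[F]_n) :
  delta_mx i j *m M *m delta_mx k l = M j k *: delta_mx i l.
Proof.
apply/matrixP=> a b; rewrite mul_deltaE delta_mulE !mxE.
by rewrite -mulrA mulrCA -natrM mulnb.
Qed.

Lemma free_dual (F : fieldType) (V : vectType F) (T : finType) (v : T -> V)
    (c : T -> V -> F^o) :
  (forall x, linear (c x)) -> (forall x y, c x (v y) = (x == y)%:R) ->
  free [seq v x | x : T].
Proof.
move=> c_lin cv; rewrite /image_mem; elim: (enum _) (enum_uniq T) => [|x s IH] /=.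
  by rewrite nil_free.
case/andP=> xs us; rewrite free_cons IH // andbT; apply/negP => vx.
have : (<<[seq v y | y <- s]>> <= lker (linfun (mklin (c_lin x))))%VS.
  apply/span_subvP => _ /mapP[y ys ->]; rewrite memv_ker lfunE /= cv.
  by case: (x =P y) xs => // ->; rewrite ys.
move/subvP/(_ _ vx); rewrite memv_ker lfunE /= cv eqxx.
by rewrite oner_eq0.
Qed.

Section Cells.
Variables (F : fieldType) (A : falgType F) (n r : nat) (cl : 'I_n -> 'I_r.+1).
Variable co : pair_coords cl A.
Implicit Types (u v w a : A) (f g : 'M[F]_n) (i j k : 'I_n) (l c : 'I_r.+1).

Let K : 'M[F]_n := size_mx F cl.
Notation linked := (linked cl).
Notation jm := (ones_part co).
Notation dm := (match_part co).
Notation mk := (of_parts co).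

Lemma linked0 : linked_mx cl (0 : 'M[F]_n).
Proof. by move=> i j _; rewrite mxE. Qed.
#[local] Hint Resolve linked0 : core.

Lemma linked_delta i j : linked i j -> linked_mx cl (delta_mx i j : 'M[F]_n).
Proof.
move=> ij a b; rewrite mxE.
by case: eqP => //= ->; case: eqP => //= ->; rewrite ij.
Qed.

Lemma coords_inj u v : jm u = jm v -> dm u = dm v -> u = v.
Proof. by move=> jE dE; rewrite -(of_partsK co u) jE dE of_partsK. Qed.

Definition ones_unit i j : A := mk (delta_mx i j) 0.
Definition match_unit i j : A := mk 0 (delta_mx i j).
Notation J := ones_unit.
Notation D := match_unit.

Lemma ones_part_ones i j : jm (J i j) = delta_mx i j. Proof. exact: ones_part_of. Qed.
Lemma match_part_ones i j : dm (J i j) = 0. Proof. exact: match_part_of. Qed.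
Lemma ones_part_match i j : linked i j -> jm (D i j) = 0.
Proof. by move=> ij; apply/ones_part_of/linked_delta. Qed.
Lemma match_part_match i j : linked i j -> dm (D i j) = delta_mx i j.
Proof. by move=> ij; apply/match_part_of/linked_delta. Qed.

Lemma linked_cl i j : cl i = cl j -> cl i != ord0 -> linked i j.
Proof. by move=> ij i0; rewrite linkedE ij eqxx -ij. Qed.

Lemma size_mxE i j : K i j = if i == j then (if cl i == ord0 then 1 else 2%:R) else 0.
Proof. by rewrite !mxE mulrb. Qed.

Lemma coords_sum u :
  u = \sum_i \sum_j jm u i j *: J i j
    + \sum_i \sum_(j | linked i j) dm u i j *: D i j.
Proof.
apply: coords_inj; rewrite !(linearD, linear_sum) /=.
  rewrite [X in _ + X]big1 ?addr0 => [|i _]; last first.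
    by rewrite linear_sum big1 // => j ij;
      rewrite linearZ /= ones_part_match // scaler0.
  rewrite {1}[jm u]matrix_sum_delta; apply: eq_bigr => i _.
  by rewrite linear_sum; apply: eq_bigr => j _; rewrite linearZ /= ones_part_ones.
rewrite big1 ?add0r => [|i _]; last first.
  by rewrite linear_sum big1 // => j _; rewrite linearZ /= match_part_ones scaler0.
rewrite {1}[dm u]matrix_sum_delta; apply: eq_bigr => i _.
rewrite linear_sum (bigID (linked i)) /= [X in _ + X]big1 ?addr0.
  by apply: eq_bigr => j ij; rewrite linearZ /= match_part_match.
by move=> j ij; rewrite match_part_linked // scale0r.
Qed.

(** The cell with label 0 consists of all J_ij; every other label l has the
    cell of the D_ij inside the class l. *)
Definition cell_index l : finType := {i : 'I_n | (l == ord0) || (cl i == l)}.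
Definition cell_pos l (U : cell_index l) : 'I_n := val U.
Arguments cell_pos : simpl never.

Lemma cell_pos_inj l : injective (@cell_pos l). Proof. exact: val_inj. Qed.

Definition cell l (U V : cell_index l) : A :=
  if l == ord0 then J (cell_pos U) (cell_pos V) else D (cell_pos U) (cell_pos V).

Lemma cell_block l (U V : cell_index l) :
  l != ord0 -> cell U V = D (cell_pos U) (cell_pos V).
Proof. by move=> /negPf l0; rewrite /cell l0. Qed.

Definition cells : finType := {l : 'I_r.+1 & (cell_index l * cell_index l)%type}.
Definition cell_of (x : cells) : A := cell (tagged x).1 (tagged x).2.

Lemma cell_cl l (U : cell_index l) : l != ord0 -> cl (cell_pos U) = l.
Proof.
move=> /negPf l0; have : (l == ord0) || (cl (cell_pos U) == l) := valP U.
by rewrite l0 => /eqP.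
Qed.

Lemma cell_linked l (U V : cell_index l) :
  l != ord0 -> linked (cell_pos U) (cell_pos V).
Proof. by move=> l0; apply: linked_cl; rewrite !cell_cl. Qed.

(** The label and the two positions determine a cell index; this avoids
    comparing the dependently typed positions of different cells. *)
Lemma cells_inj :
  injective (fun x : cells => (tag x, (cell_pos (tagged x).1, cell_pos (tagged x).2))).
Proof.
case=> [l [U V]] [l' [U' V']] /= [ll' UU' VV']; subst l'.
by rewrite (cell_pos_inj UU') (cell_pos_inj VV').
Qed.

Definition cell_coord (x : cells) u : F :=
  (if tag x == ord0 then jm u else dm u)
    (cell_pos (tagged x).1) (cell_pos (tagged x).2).

Lemma cell_coord_linear x : linear (cell_coord x : A -> F^o).
Proof.
by move=> a u v; rewrite /cell_coord; case: eqP => _; rewrite linearP !mxE.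
Qed.

Lemma cell_coord_cell x y : cell_coord x (cell_of y) = (x == y)%:R.
Proof.
rewrite -(inj_eq cells_inj) /cell_coord /cell_of /cell !xpair_eqE.
case: x y => [l [U V]] [l' [U' V']] /=.
case: (boolP (l == ord0)) => l0; case: (boolP (l' == ord0)) => l'0.
- have -> : l == l' by rewrite (eqP l0) (eqP l'0).
  by rewrite ones_part_ones mxE.
- have /negPf -> : l != l' by rewrite (eqP l0) eq_sym.
  by rewrite ones_part_match ?mxE // cell_linked.
- have /negPf -> : l != l' by rewrite (eqP l'0).
  by rewrite match_part_ones mxE.
rewrite match_part_match ?cell_linked // mxE; case: (l =P l') => //= ll'.
case: eqP => //= UU'; case: eqP => //= VV'; case: ll'.
by rewrite -(cell_cl U) // UU' cell_cl.
Qed.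

Definition bottom_index i : cell_index ord0 := exist _ i isT.
Definition bottom_cell i j : cells :=
  existT (fun l => (cell_index l * cell_index l)%type) ord0
    (bottom_index i, bottom_index j).

Lemma bottom_cellE i j : cell_of (bottom_cell i j) = J i j.
Proof. by []. Qed.

Fact block_index_subproof i j : linked i j -> (cl i == ord0) || (cl j == cl i).
Proof. by case/andP => /eqP ->; rewrite eqxx orbT. Qed.

Definition block_cell i j (ij : linked i j) : cells :=
  existT (fun l => (cell_index l * cell_index l)%type) (cl i)
    (exist _ i (introT orP (or_intror (eqxx (cl i)))),
     exist _ j (block_index_subproof ij)).

Lemma block_cellE i j (ij : linked i j) : cell_of (block_cell ij) = D i j.
Proof. by case/andP: (ij) => _ i0; rewrite /cell_of cell_block. Qed.

Lemma cells_basis : basis_of fullv [seq cell_of x | x : cells].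
Proof.
rewrite /basis_of (free_dual cell_coord_linear cell_coord_cell) andbT eqEsubv.
rewrite subvf /=; apply/subvP=> u _; rewrite [u]coords_sum.
apply: memvD; apply: memv_suml => i _; apply: memv_suml => j ij.
  by apply/memvZ/memv_span; rewrite -bottom_cellE map_f // mem_enum.
by apply/memvZ/memv_span; rewrite -(block_cellE ij) map_f // mem_enum.
Qed.

(** The J_ij span an ideal that lies below all other cells. *)
Lemma bottom_span l u : l != ord0 -> dm u = 0 ->
  u \in <<[seq cell_of x | x <- enum cells & (tag x < l)%O]>>%VS.
Proof.
move=> l0 du; rewrite [u]coords_sum du [X in _ + X]big1 ?addr0 => [|i _]; last first.
  by rewrite big1 // => j _; rewrite mxE scale0r.
apply: memv_suml => i _; apply: memv_suml => j _.
apply/memvZ/memv_span; rewrite -bottom_cellE map_f //.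
by rewrite mem_filter mem_enum andbT /= Order.POrderTheory.lt_neqAle eq_sym l0
  Order.le0x.
Qed.

(** Left multiplication by a changes only the row index of a J_ij, and modulo
    the J_ij it changes only the row index of a D_ij; the coefficients are
    read off the parts of a and do not involve the column. *)
Lemma cells_cellular (t : {linear A -> A}) :
    (forall u, jm (t u) = (jm u)^T) -> (forall u, dm (t u) = (dm u)^T) ->
  cellular_wrt t.
Proof.
move=> jmt dmt.
have K_sym : K^T = K by exact: tr_diag_mx.
exists _, 'I_r.+1, cell_index, cell; split.
- exact: cells_basis.
- split=> [u v|u]; apply: coords_inj; rewrite ?(jmt, dmt, trmxK) //.
    rewrite !ones_partM !linearD /= !trmx_mul K_sym !(jmt, dmt) mulmxA.
    by rewrite -!addrA; congr (_ + _); rewrite addrC.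
  by rewrite !match_partM trmx_mul !dmt.
- move=> l U V; rewrite /cell; case: eqP => l0; apply: coords_inj.
  + by rewrite jmt !ones_part_ones trmx_delta.
  + by rewrite dmt !match_part_ones trmx0.
  + by rewrite jmt !ones_part_match ?trmx0 // cell_linked //; apply/eqP.
  by rewrite dmt !match_part_match ?trmx_delta // cell_linked //; apply/eqP.
move=> a l; have [->|l0] := eqVneq l ord0.
  exists (fun (W U : cell_index ord0) =>
    (jm a *m K + dm a) (cell_pos W) (cell_pos U)) => U V.
  rewrite /cell eqxx; set s := \sum_W _.
  suff -> : a * J (cell_pos U) (cell_pos V) = s by rewrite subrr mem0v.
  have -> : s = \sum_i (jm a *m K + dm a) i (cell_pos U) *: J i (cell_pos V).
    rewrite /s (reindex bottom_index) //=; exists (@cell_pos ord0) => // W _.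
    exact: (@cell_pos_inj ord0).
  apply: coords_inj.
    rewrite ones_partM !ones_part_ones match_part_ones mulmx0 addr0 -mulmxDl linear_sum.
    move: (jm a *m K + dm a) => f; apply/matrixP=> i j.
    rewrite mul_deltaE summxE (bigD1 i) //= linearZ /= ones_part_ones !mxE eqxx /=.
    rewrite big1 ?addr0 // => k ki.
    by rewrite linearZ /= ones_part_ones !mxE eq_sym (negPf ki) mulr0.
  rewrite match_partM match_part_ones mulmx0 linear_sum big1 // => i _.
  by rewrite linearZ /= match_part_ones scaler0.
exists (fun (W U : cell_index l) => dm a (cell_pos W) (cell_pos U)) => U V.
apply: bottom_span => //; rewrite linearB linear_sum /= cell_block //.
rewrite match_partM match_part_match ?cell_linked //; apply/eqP; rewrite subr_eq0;
  apply/eqP.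
under eq_bigr => W _ do rewrite linearZ /= cell_block // match_part_match
  ?cell_linked //.
apply/matrixP=> i j; rewrite mul_deltaE summxE.
have [il|il] := eqVneq (cl i) l.
  have iP : (l == ord0) || (cl i == l) by rewrite il eqxx orbT.
  rewrite (bigD1 (exist _ i iP)) //= !mxE eqxx big1 ?addr0 // => W Wi.
  rewrite !mxE; case: eqP => iW; last by rewrite mulr0.
  by case/eqP: Wi; apply: cell_pos_inj.
rewrite match_part_linked ?mul0r ?big1 // => [W _|].
  rewrite !mxE; case: eqP => iW; last by rewrite mulr0.
  by rewrite iW cell_cl ?eqxx in il.
by rewrite linkedE cell_cl // (negPf il).
Qed.

End Cells.

Arguments coords_inj {F A n r cl} co {u v}.

(** * The heredity chain *)

Section Layers.
Variables (F : fieldType) (A : falgType F) (n r : nat) (cl : 'I_n -> 'I_r.+1).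
Variables (rp : 'I_r.+1 -> 'I_n) (clK : cancel rp cl) (co : pair_coords cl A).
Implicit Types (u v w a : A) (f g : 'M[F]_n) (i j k : 'I_n) (l c : 'I_r.+1).
Implicit Types (m : nat).

Let K : 'M[F]_n := size_mx F cl.
Notation linked := (linked cl).
Notation jm := (ones_part co).
Notation dm := (match_part co).
Notation mk := (of_parts co).
Notation J := (ones_unit co).
Notation D := (match_unit co).
#[local] Hint Resolve linked0 : core.

(** The span of the cells with labels smaller than m. *)
Definition layer_pred m : {pred A} := fun u =>
  ((m == 0) ==> (jm u == 0)) &&
  [forall i, forall j, (m <= cl i)%N ==> (dm u i j == 0)].

Lemma layerP m u :
  reflect ((m = 0 -> jm u = 0) /\ forall i j, (m <= cl i)%N -> dm u i j = 0)
    (u \in layer_pred m).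
Proof.
apply: (iffP andP) => -[ju du]; split.
- by move=> m0; apply/eqP; move: ju; rewrite m0.
- by move=> i j mi; move/forallP/(_ i)/forallP/(_ j)/implyP/(_ mi)/eqP: du.
- by apply/implyP => /eqP m0; apply/eqP/ju.
- by apply/forallP=> i; apply/forallP=> j; apply/implyP => mi; apply/eqP/du.
Qed.

Fact layer_zmod m : zmod_closed (layer_pred m).
Proof.
split=> [|u v /layerP[ju du] /layerP[jv dv]]; apply/layerP.
  by rewrite !linear0; split=> // i j _; rewrite mxE.
rewrite !linearB; split=> [m0|i j mi]; first by rewrite ju ?jv ?subrr.
by rewrite !mxE du ?dv ?subrr.
Qed.

Lemma layer0 u : (u \in layer_pred 0) = (u == 0).
Proof.
apply/layerP/eqP => [[ju du]|->].
  apply: (coords_inj co); rewrite !linear0; first exact: ju.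
  by apply/matrixP=> i j; rewrite mxE du.
by rewrite !linear0; split=> // i j _; rewrite mxE.
Qed.

Fact layer_mull m a u : u \in layer_pred m -> a * u \in layer_pred m.
Proof.
case: m => [|m]; first by rewrite !layer0 => /eqP ->; rewrite mulr0.
move=> /layerP[_ du]; apply/layerP; split=> // i j mi.
rewrite match_partM mxE big1 // => k _; have [ik|ik] := boolP (linked i k).
  by rewrite du ?mulr0 //; case/andP: ik => /eqP <-.
by rewrite match_part_linked ?mul0r.
Qed.

Fact layer_mulr m a u : u \in layer_pred m -> u * a \in layer_pred m.
Proof.
case: m => [|m]; first by rewrite !layer0 => /eqP ->; rewrite mul0r.
move=> /layerP[_ du]; apply/layerP; split=> // i j mi.
by rewrite match_partM mxE big1 // => k _; rewrite du ?mul0r.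
Qed.

Definition layer m : ideal A :=
  Ideal (@layer_zmod m) (@layer_mull m) (@layer_mulr m).

Lemma layer_sub m : {subset layer m <= layer m.+1}.
Proof.
move=> u /layerP[ju du]; apply/layerP; split=> // i j /ltnW; exact: du.
Qed.

(** With o the index of a one-point block, J_ij = J_io J_oj, so that this
    layer is A e A for the idempotent e = J_oo. The dual basis consists of the
    J_ok, whose coordinate functions move column k of the coefficient matrix
    to column o. Every J_ab w J_ij is a multiple of J_aj, which gives the
    simplicity. *)
Lemma layer_heredity0 (h : 1 \notin layer 0) : heredity (qimage h (layer 1)).
Proof.
pose o := rp ord0; have Ko : K o o = 1 by rewrite size_mxE eqxx clK.
have layer1P u : (u \in layer 1) = (dm u == 0).
  apply/layerP/eqP => [[_ du]|->]; last by split=> // i j _; rewrite mxE.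
  apply/matrixP=> i j; rewrite mxE; have [i0|] := posnP (cl i); last exact: du.
  by rewrite match_part_linked //; apply/nandP; right; rewrite negbK -val_eqE /= i0.
pose phi k u := mk (jm u *m delta_mx k o) 0.
have jm_phi k u : jm (phi k u) = jm u *m delta_mx k o by apply: ones_part_of.
have dm_phi k u : dm (phi k u) = 0 by apply: match_part_of.
have add_phi k : zmod_morphism (phi k).
  move=> u v; apply: (coords_inj co); rewrite !linearB ?dm_phi ?subrr //.
  by rewrite !jm_phi linearB mulmxBl.
pose phiA k : {additive A -> A} :=
  HB.pack (phi k) (GRing.isZmodMorphism.Build A A (phi k) (add_phi k)).
have in0 u : (u \in layer 0) = (u == 0) by exact: layer0.
apply: (@heredity_quotient _ _ _ _ (@layer_sub 0) h 'I_n (J o) phiA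
  (fun v => exists s i j, v = s *: J i j)) => [k|k u|k u|k a u|u|u|v u w] /=.
- by rewrite layer1P match_part_ones.
- by rewrite !layer1P dm_phi.
- rewrite !in0 => /eqP ->; apply/eqP; exact: (raddf0 (phiA k)).
- rewrite layer1P => /eqP du; rewrite in0 subr_eq0; apply/eqP.
  apply: (coords_inj co); rewrite ?ones_partM ?match_partM !(jm_phi, dm_phi) ?mulmx0 //.
  by rewrite ones_partM du !mulmx0 !addr0 !mulmxDl !mulmxA.
- rewrite layer1P => /eqP du; rewrite in0 subr_eq0; apply/eqP.
  apply: (coords_inj co); rewrite linear_sum /=; last first.
    by rewrite du big1 // => k _; rewrite match_partM match_part_ones mulmx0.
  under eq_bigr => k _.
    rewrite ones_partM jm_phi dm_phi ones_part_ones match_part_ones mul0mx mulmx0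
      !addr0 -!mulmxA.
    rewrite (mulmxA (delta_mx k o)) delta_mul_delta Ko scale1r.
    over.
  rewrite -mulmx_sumr -[LHS]mulmx1; congr (_ *m _).
  by rewrite -diag_const_mx diag_mx_sum_delta; apply: eq_bigr => k _;
    rewrite mxE scale1r.
- rewrite layer1P => /eqP du.
  exists [seq jm u ij.1 ij.2 *: J ij.1 ij.2 | ij : 'I_n * 'I_n]; split=> [g|].
    by case/mapP=> ij _ ->; exists (jm u ij.1 ij.2), ij.1, ij.2.
  rewrite in0 subr_eq0 big_map big_enum; apply/eqP.
  rewrite {1}[u](coords_sum co) du [X in _ + X]big1 ?addr0 => [|i _].
    by rewrite pair_bigA.
  by rewrite big1 // => j _; rewrite mxE scale0r.
case=> s [i [j ->]]; rewrite layer1P in0 => /eqP du.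
rewrite -scalerAr scaler_eq0 => /norP[s0 uwJ].
(* The form that decides when J_ab w J_ij, a multiple of J_aj, is nonzero. *)
pose g := K *m (jm w *m K + dm w).
have uwJE : u * w * J i j = mk (jm u *m g *m delta_mx i j) 0.
  apply: (coords_inj co);
    rewrite ?ones_part_of ?match_part_of // ?match_partM ?match_part_ones ?mulmx0 //.
  rewrite -mulrA !ones_partM !match_partM ones_part_ones du match_part_ones !mul0mx
    !mulmx0 !addr0 -mulmxDl.
  by rewrite !mulmxA.
have [b gbi] : exists b, g b i != 0.
  apply: contrapT => gi; case/eqP: uwJ; rewrite uwJE.
  suff -> : jm u *m g *m delta_mx i j = 0.
    by apply: (coords_inj co); rewrite ?ones_part_of ?match_part_of // linear0.
  apply/matrixP=> a c; rewrite mul_deltaE !mxE big1 ?mul0r // => b _.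
  have -> : g b i = 0 by apply/eqP/negPn/negP => gbi; apply: gi; exists b.
  by rewrite mulr0.
exists ((g b i)^-1 *: J i b); rewrite in0 subr_eq0; apply/eqP.
rewrite -scalerAr; congr (_ *: _); rewrite -!scalerAl.
apply: (coords_inj co); rewrite linearZ /=; last first.
  by rewrite !match_partM !match_part_ones !mulmx0 scaler0.
rewrite -mulrA !ones_partM !match_partM !ones_part_ones !match_part_ones !mul0mx
  !mulmx0 !addr0 -mulmxDl.
rewrite -!mulmxA (mulmxA K) -/g mulmxA delta_mul_delta scalerA mulVf //.
by rewrite scale1r.
Qed.

(** Modulo the lower layers the D_ij of the class m multiply like matrix
    units; the identity [eps] of this matrix algebra is a right identity of
    the layer, and serves alone as a dual basis. *)
Lemma layer_heredity m (h : 1 \notin layer m) :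
  (0 < m)%N -> heredity (qimage h (layer m.+1)).
Proof.
move=> m0; have layerPm u :
    reflect (forall i j, (m <= cl i)%N -> dm u i j = 0) (u \in layer m).
  apply: (iffP (layerP m u)) => [[]//|du]; split=> // mE.
  by rewrite mE ltnn in m0.
have layer1P u : reflect (forall i j, (m < cl i)%N -> dm u i j = 0) (u \in layer m.+1).
  by apply: (iffP (layerP m.+1 u)) => [[]//|du]; split.
pose e := diag_mx (\row_i ((cl i : nat) == m)%:R) : 'M[F]_n.
have e_linked : linked_mx cl e.
  move=> i j; rewrite !mxE; case: (i =P j) => [<-|_ _]; last by rewrite mulr0n.
  rewrite linkedE eqxx /= negbK => /eqP i0.
  by rewrite i0 /= (ltn_eqF m0).
pose eps := mk 0 e.
have dm_eps : dm eps = e by exact: match_part_of.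
pose in_block (ij : 'I_n * 'I_n) := linked ij.1 ij.2 && (cl ij.1 == m :> nat).
apply: (@heredity_quotient _ _ _ _ (@layer_sub m) h unit
  (fun _ => eps) (fun _ => idfun)
  (fun v => exists s i j, [/\ linked i j, cl i = m :> nat & v = s *: D i j]))
  => [k|k u|k u|k a u|u|u|v u w] //=.
- apply/layer1P => i j mi; rewrite dm_eps !mxE.
  by rewrite [_ == m]gtn_eqF // mul0rn.
- by rewrite subrr (layer_zmod m).1.
- move/layer1P=> du; rewrite big_const card_unit /= addr0.
  apply/layerPm => i j; rewrite leq_eqVlt linearB match_partM dm_eps => mi.
  rewrite mxE [X in _ + X]mxE [X in _ - X](_ : _ = dm u i j * e j j).
    case/orP: mi => [/eqP mi|mi]; last by rewrite du // mul0r subrr.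
    have [ij|ij] := boolP (linked i j);
      last by rewrite match_part_linked // mul0r subrr.
    case/andP: ij => /eqP ij _.
    by rewrite !mxE -ij -mi !eqxx mulr1n mulr1 subrr.
  rewrite mxE (bigD1 j) //= big1 ?addr0 // => k kj.
  by rewrite [e k j]mxE (negPf kj) mulr0n mulr0.
- move/layer1P=> du.
  exists [seq dm u ij.1 ij.2 *: D ij.1 ij.2 | ij <- enum {: 'I_n * 'I_n} & in_block ij].
  split=> [g|].
    case/mapP=> ij; rewrite mem_filter => /andP[/andP[ijl /eqP ijm] _] ->.
    by exists (dm u ij.1 ij.2), ij.1, ij.2.
  rewrite big_map big_filter big_enum_cond; apply/layerPm => a b ma.
  rewrite linearB linear_sum !mxE summxE.
  rewrite (eq_bigr (fun ij => dm u ij.1 ij.2 * ((a == ij.1) && (b == ij.2))%:R)).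
    have [ab|ab] := boolP (in_block (a, b)).
      rewrite (bigD1 (a, b)) //= !eqxx mulr1 big1 ?addr0 ?subrr // => -[i j].
      case/andP=> _ /= ne; rewrite [a == _]eq_sym [b == _]eq_sym -xpair_eqE.
      by rewrite (negPf ne) mulr0.
    rewrite big1 => [|[i j] /andP[_ ij]]; last first.
      case: eqP => [ai|_]; last by rewrite mulr0.
      case: eqP => [bj|_]; last by rewrite mulr0.
      by rewrite ai bj ij in ab.
    rewrite subr0; move: ma; rewrite leq_eqVlt => /orP[/eqP ma|]; last exact: du.
    by move: ab; rewrite /in_block /= -ma eqxx andbT; exact: match_part_linked.
  by move=> ij /andP[_ /andP[ijl _]]; rewrite linearZ /= match_part_match // !mxE.
case=> s [i [j [ij im ->]]] _ uwD.
have [b wbi] : exists b, linked b i /\ dm w b i != 0.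
  apply: contrapT => wi; case/negP: uwD; apply/layerPm => a c ma.
  rewrite -scalerAr linearZ /= mxE -mulrA !match_partM match_part_match // mxE big1
    ?mulr0 // => b _.
  rewrite mul_deltaE.
  suff -> : dm w b i = 0 by rewrite mul0r mulr0.
  have [bi|bi] := boolP (linked b i); last by rewrite match_part_linked.
  by apply/eqP/negPn/negP => wbi; apply: wi; exists b.
case: wbi => bi wbi; have ib : linked i b.
  by case/andP: bi => /eqP bi b0; rewrite linked_cl // -bi.
exists ((dm w b i)^-1 *: D i b); apply/layerPm => a c ma.
rewrite -scalerAr -!scalerAl -scalerBr linearZ /= mxE linearB linearZ /=.
rewrite !match_partM !match_part_match // delta_mul_delta scalerA mulVf // scale1r
  subrr mxE.
by rewrite mulr0.
Qed.

Lemma coords_quasi_hereditary : quasi_hereditary A.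
Proof.
exists r.+1, layer; split=> [u|u|m mr]; first exact: layer0.
  by apply/layerP; split=> // i j; rewrite leqNgt ltn_ord.
have [u u1 u0] : exists2 u, u \in layer m.+1 & u \notin layer m.
  case: (posnP m) => [->|m0].
    exists (J (rp ord0) (rp ord0)); last first.
      rewrite [_ \in _]layer0; apply/eqP.
      move/(congr1 (fun u => jm u (rp ord0) (rp ord0))).
      by rewrite ones_part_ones linear0 !mxE !eqxx => /eqP; rewrite oner_eq0.
    by apply/layerP; split=> // i j _; rewrite match_part_ones mxE.
  pose c := rp (inord m).
  have cm : cl c = m :> nat by rewrite clK inordK.
  have cc : linked c c by apply: linked_cl; rewrite // -val_eqE /= cm -lt0n.
  exists (D c c); last first.
    apply/negP => /layerP[_ /(_ c c)]; rewrite match_part_match // mxE !eqxx cm leqnn.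
    by move/(_ isT)/eqP; rewrite oner_eq0.
  apply/layerP; split=> // i j mi; rewrite match_part_match // mxE.
  by case: eqP mi => // ->; rewrite cm ltnn.
have h : 1 \notin layer m.
  by apply: contra u0 => /(ideal_mull u); rewrite mulr1.
split; [exact: layer_sub | by exists u | exists h].
case: (posnP m) => [m0|m0]; last exact: layer_heredity.
by move: h; rewrite m0 => h; exact: layer_heredity0.
Qed.

End Layers.

(** * The indecomposable projective modules in characteristic two *)

Section CharTwo.
Variables (F : fieldType) (A : falgType F) (n r : nat) (cl : 'I_n -> 'I_r.+1).
Variables (rp : 'I_r.+1 -> 'I_n) (clK : cancel rp cl) (co : pair_coords cl A).
Implicit Types (u x a b : A) (f g : 'M[F]_n) (i j k : 'I_n) (v w : 'I_r.+1).

Let K : 'M[F]_n := size_mx F cl.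
Notation linked := (linked cl).
Notation jm := (ones_part co).
Notation dm := (match_part co).
Notation mk := (of_parts co).
Notation J := (ones_unit co).
Notation D := (match_unit co).
#[local] Hint Resolve linked0 : core.

Definition vertex_idem v : A := if v == ord0 then J (rp v) (rp v) else D (rp v) (rp v).
Notation E := vertex_idem.
Notation delta v := (delta_mx (rp v) (rp v)).

Lemma linked_rp v : linked (rp v) (rp v) = (v != ord0).
Proof. by rewrite linkedE eqxx clK. Qed.

Lemma rp_inj : injective rp. Proof. exact: can_inj clK. Qed.

Lemma ones_part_vertex v : jm (E v) = if v == ord0 then delta v else 0.
Proof.
by rewrite /E; case: eqVneq => v0;
  rewrite ?ones_part_ones // ones_part_match // linked_rp.
Qed.

Lemma match_part_vertex v : dm (E v) = if v == ord0 then 0 else delta v.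
Proof.
by rewrite /E; case: eqVneq => v0;
  rewrite ?match_part_ones // match_part_match // linked_rp.
Qed.

Lemma delta_size_thin i : cl i = ord0 -> forall j, delta_mx j i *m K = delta_mx j i.
Proof.
move=> i0 j; apply/matrixP=> a b; rewrite delta_mulE size_mxE i0 eqxx mxE.
by rewrite [b == i]eq_sym; case: (i == b); rewrite ?mulr1 ?mulr0 ?andbT ?andbF.
Qed.

Lemma size_delta_thin i : cl i = ord0 -> forall j, K *m delta_mx i j = delta_mx i j.
Proof.
move=> i0 j; apply/matrixP=> a b; rewrite mul_deltaE size_mxE mxE.
by case: eqP => [->|]; rewrite ?i0 ?eqxx ?mul1r ?mul0r.
Qed.

Lemma match_part_thinl u i j : cl i = ord0 -> dm u i j = 0.
Proof. by move=> i0; rewrite match_part_linked // linkedE i0 eqxx andbF. Qed.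

Lemma match_part_thinr u i j : cl j = ord0 -> dm u i j = 0.
Proof.
by move=> j0; rewrite match_part_linked // linkedE j0; case: eqP => // ->.
Qed.

(** Also when v = 0, where E v is a J_oo, multiplication by E v acts on both
    parts as a matrix unit: a one-point block counts with size 1 in the
    product, and it is linked to nothing, so that the match part has no
    contribution. *)
Lemma ones_part_vertexM v u : jm (E v * u) = delta v *m jm u.
Proof.
rewrite ones_partM ones_part_vertex match_part_vertex; have [v0|_] := eqVneq v ord0;
  last first.
  by rewrite !mul0mx add0r addr0.
rewrite delta_size_thin ?clK // mul0mx addr0.
rewrite -[RHS]addr0; congr (_ + _).
by apply/matrixP=> i j; rewrite delta_mulE match_part_thinl ?mulr0 ?mxE // clK.
Qed.

Lemma ones_part_Mvertex v u : jm (u * E v) = jm u *m delta v.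
Proof.
rewrite ones_partM ones_part_vertex match_part_vertex; have [v0|_] := eqVneq v ord0;
  last first.
  by rewrite !mulmx0 !add0r.
rewrite -mulmxA size_delta_thin ?clK // mulmx0 addr0.
rewrite -[RHS]addr0; congr (_ + _).
by apply/matrixP=> i j; rewrite mul_deltaE match_part_thinr ?mul0r ?mxE // clK.
Qed.

Lemma match_part_vertexM v u : dm (E v * u) = delta v *m dm u.
Proof.
rewrite match_partM match_part_vertex; have [v0|//] := eqVneq v ord0; rewrite mul0mx.
by apply/matrixP=> i j; rewrite delta_mulE match_part_thinl ?mulr0 ?mxE // clK.
Qed.

Lemma match_part_Mvertex v u : dm (u * E v) = dm u *m delta v.
Proof.
rewrite match_partM match_part_vertex; have [v0|//] := eqVneq v ord0; rewrite mulmx0.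
by apply/matrixP=> i j; rewrite mul_deltaE match_part_thinr ?mul0r ?mxE // clK.
Qed.

(** The homomorphisms from A E_v to A E_w: one J, and the identity if v = w. *)
Lemma vertex_corner v w u :
  E v * u * E w = jm u (rp v) (rp w) *: J (rp v) (rp w)
    + (if v == w then dm u (rp v) (rp w) else 0) *: E v.
Proof.
apply: (coords_inj co).
  rewrite ones_part_Mvertex ones_part_vertexM delta_mul_delta linearD !linearZ /=
    ones_part_ones ones_part_vertex.
  case: (eqVneq v w) => [<-|]; last by rewrite scale0r addr0.
  case: eqP => [v0|_]; last by rewrite scaler0 addr0.
  by rewrite (@match_part_thinl u (rp v) (rp v)) ?clK // scale0r addr0.
rewrite match_part_Mvertex match_part_vertexM delta_mul_delta linearD !linearZ /=
  match_part_ones match_part_vertex.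
rewrite scaler0 add0r; have [<-|vw] := eqVneq v w.
  case: eqP => // v0; rewrite (@match_part_thinl u (rp v) (rp v)) ?clK //.
  by rewrite !scale0r.
by rewrite match_part_linked ?scale0r // linkedE !clK (negPf vw).
Qed.

Lemma vertex_orth v w : E v * E w = if v == w then E v else 0.
Proof.
apply: (coords_inj co);
  rewrite ?ones_part_Mvertex ?match_part_Mvertex ?ones_part_vertex ?match_part_vertex.
  case: (eqVneq v w) => [<-|vw].
    by rewrite ones_part_vertex; case: eqP => _; rewrite ?mul0mx // mul_delta_mx.
  rewrite linear0; case: eqP => _; rewrite ?mul0mx //.
  by rewrite mul_delta_mx_0 // (inj_eq rp_inj).
case: (eqVneq v w) => [<-|vw].
  by rewrite match_part_vertex; case: eqP => _; rewrite ?mul0mx // mul_delta_mx.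
rewrite linear0; case: eqP => _; rewrite ?mul0mx //.
by rewrite mul_delta_mx_0 // (inj_eq rp_inj).
Qed.

Lemma vertex_idem_idem v : E v * E v = E v.
Proof. by rewrite vertex_orth eqxx. Qed.

Hypothesis two0 : 2%:R = 0 :> F.

(** The span of the J_ij for which i and j are not both indices of one-point
    blocks. *)
Definition nil_pred : {pred A} := fun u => (dm u == 0) &&
  [forall i, forall j, (cl i == ord0) && (cl j == ord0) ==> (jm u i j == 0)].

Lemma nil_predP u : reflect
  (dm u = 0 /\ forall i j, cl i = ord0 -> cl j = ord0 -> jm u i j = 0)
  (u \in nil_pred).
Proof.
apply: (iffP andP) => -[du ju]; split; try exact/eqP.
  move=> i j i0 j0; move/forallP/(_ i)/forallP/(_ j): ju.
  by rewrite i0 j0 => /eqP.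
apply/forallP=> i; apply/forallP=> j; apply/implyP => /andP[/eqP i0 /eqP j0].
exact/eqP/ju.
Qed.

(** In characteristic two, the product J_ik J_kj vanishes unless k is the
    index of a one-point block. *)
Lemma size_mulE f g i j :
  (f *m K *m g) i j = \sum_(k | cl k == ord0) f i k * g k j.
Proof.
rewrite mxE (bigID (fun k => cl k == ord0)) /= [X in _ + X]big1 ?addr0.
  apply: eq_bigr => k /eqP k0; congr (_ * _).
  rewrite mxE (bigD1 k) //= big1 ?addr0; first by rewrite size_mxE eqxx k0 eqxx mulr1.
  by move=> l lk; rewrite size_mxE (negPf lk) mulr0.
move=> k /negPf k0; rewrite mxE big1 ?mul0r // => l _.
by rewrite size_mxE; case: eqP => [->|]; rewrite ?k0 ?two0 mulr0.
Qed.

Lemma nil_pred0 : 0 \in nil_pred.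
Proof. by apply/nil_predP; rewrite !linear0; split=> // i j; rewrite mxE. Qed.

Lemma nil_predD u x : u \in nil_pred -> x \in nil_pred -> u + x \in nil_pred.
Proof.
move=> /nil_predP[du ju] /nil_predP[dx jx]; apply/nil_predP;
  rewrite !linearD /= du dx addr0.
by split=> // i j i0 j0; rewrite mxE ju ?jx ?addr0.
Qed.

Lemma nil_predMl a u : u \in nil_pred -> a * u \in nil_pred.
Proof.
move=> /nil_predP[du ju]; apply/nil_predP; rewrite match_partM du mulmx0;
  split=> // i j i0 j0.
rewrite ones_partM du mulmx0 addr0 mxE size_mulE big1 ?add0r => [|k /eqP k0].
  by rewrite mxE big1 // => k _; rewrite match_part_thinl ?mul0r.
by rewrite ju ?mulr0.
Qed.

(** A nonzero product of three J would have both indices of its middle factor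
    in one-point blocks. *)
Lemma nil_pred3 u x a :
  u \in nil_pred -> x \in nil_pred -> a \in nil_pred -> u * x * a = 0.
Proof.
move=> /nil_predP[du ju] /nil_predP[dx jx] /nil_predP[da ja].
apply: (coords_inj co); rewrite linear0 ?match_partM ?du ?mul0mx //.
rewrite !ones_partM !match_partM du dx da !mul0mx !mulmx0 !addr0.
apply/matrixP=> i j; rewrite size_mulE mxE big1 // => k /eqP k0.
by rewrite size_mulE big1 ?mul0r // => l /eqP l0; rewrite jx ?mulr0.
Qed.

Lemma vertex_notin_nil v : E v \notin nil_pred.
Proof.
apply/negP => /nil_predP[]; rewrite match_part_vertex ones_part_vertex;
  have [v0 _|v0] := eqVneq v ord0.
  move/(_ (rp v) (rp v)); rewrite !clK mxE !eqxx => /(_ v0 v0)/eqP.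
  by rewrite oner_eq0.
move/matrixP/(_ (rp v) (rp v)); rewrite !mxE !eqxx => /eqP.
by rewrite oner_eq0.
Qed.

Lemma vertex_hom_nil v w a : v != w -> E v * a * E w \in nil_pred.
Proof.
move=> vw; rewrite vertex_corner (negPf vw) scale0r addr0; apply/nil_predP.
rewrite !linearZ /= match_part_ones ones_part_ones scaler0; split=> // i j i0 j0;
  rewrite !mxE.
case: eqP => [iv|]; last by rewrite mulr0.
case: eqP => [jw|]; last by rewrite mulr0.
by case/eqP: vw; rewrite -[v]clK -[w]clK -iv -jw i0 j0.
Qed.

(** Right multiplication by D_jc or J_jo moves a coefficient from column j to
    the column of a representative. *)
Lemma vertex_cover a : a \notin nil_pred -> exists c v, a * c * E v \notin nil_pred.
Proof.
move=> aN; have [[i [j aij]]|da] := pselect (exists i j, dm a i j != 0).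
  have ij : linked i j.
    by apply: contraNT aij => /match_part_linked ->.
  have [/eqP cij i0] := andP ij.
  have jc : linked j (rp (cl j)) by rewrite linked_cl ?clK // -cij.
  exists (D j (rp (cl j))), (cl j); apply/negP => /nil_predP[].
  rewrite match_part_Mvertex match_partM match_part_match // -mulmxA mul_delta_mx.
  move/matrixP/(_ i (rp (cl j))); rewrite mul_deltaE eqxx mulr1 mxE.
  by move/eqP; rewrite (negPf aij).
have {}da : dm a = 0.
  apply/matrixP=> i j; rewrite mxE; apply/eqP/negPn/negP => aij.
  by apply: da; exists i, j.
have [i [j [i0 j0 aij]]] : exists i j, [/\ cl i = ord0, cl j = ord0 & jm a i j != 0].
  apply: contrapT => ja; case/negP: aN; apply/nil_predP; split=> // i j i0 j0.
  by apply/eqP/negPn/negP => aij; apply: ja; exists i, j.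
exists (J j (rp ord0)), ord0; apply/negP => /nil_predP[_ /(_ i (rp ord0) i0 (clK _))].
rewrite ones_part_Mvertex ones_partM da ones_part_ones match_part_ones mul0mx mulmx0
  !addr0 -!mulmxA.
rewrite mul_delta_mx size_delta_thin // mul_deltaE eqxx mulr1.
by move/eqP; rewrite (negPf aij).
Qed.

(** An element of A E_v outside the nilpotent ideal has a multiple of the form
    E_v + f J in E_v A E_v. For v = 0 this is a scalar multiple of E_v; for
    the other v it has the inverse E_v - f J, because J J = 2 J = 0. *)
Lemma vertex_local v u :
  u * E v = u -> u \notin nil_pred -> exists b, b * u = E v.
Proof.
move=> uE uN; have ju : jm u = jm u *m delta v by rewrite -ones_part_Mvertex uE.
have du : dm u = dm u *m delta v by rewrite -match_part_Mvertex uE.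
have [v0|v0] := eqVneq v ord0.
  have {}du : dm u = 0.
    rewrite du; apply/matrixP=> i j.
    by rewrite mul_deltaE match_part_thinr ?mul0r ?mxE // clK.
  have [i [i0 uiv]] : exists i, cl i = ord0 /\ jm u i (rp v) != 0.
    apply: contrapT => ju0; case/negP: uN; apply/nil_predP; split=> // i j i0 j0.
    rewrite ju mul_deltaE; suff -> : jm u i (rp v) = 0 by rewrite mul0r.
    by apply/eqP/negPn/negP => uiv; apply: ju0; exists i.
  exists ((jm u i (rp v))^-1 *: J (rp v) i); rewrite -scalerAl.
  apply: (coords_inj co);
    rewrite linearZ /= ?ones_part_vertex ?match_part_vertex v0 eqxx -?v0.
    rewrite ones_partM du match_part_ones ones_part_ones mul0mx mulmx0 !addr0
      delta_size_thin // ju mulmxA.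
    by rewrite delta_mul_delta mul_deltaE eqxx mulr1 scalerA mulVf // scale1r.
  by rewrite match_partM du mulmx0 scaler0.
set c := rp v; have [i uic] : exists i, dm u i c != 0.
  apply: contrapT => du0; case/negP: uN; apply/nil_predP; split=> [|i j i0 j0].
    apply/matrixP=> i j; rewrite du mul_deltaE mxE.
    suff -> : dm u i (rp v) = 0 by rewrite mul0r.
    by apply/eqP/negPn/negP => uic; apply: du0; exists i.
  rewrite ju mul_deltaE; case: eqP => [jv|]; last by rewrite mulr0.
  by rewrite jv clK in j0; rewrite j0 eqxx in v0.
have ic : linked i c by apply: contraNT uic => /match_part_linked ->.
have ci : linked c i.
  by case/andP: ic => /eqP ic i0; rewrite linked_cl // -ic.
pose b1 := (dm u i c)^-1 *: D c i; pose f := (dm u i c)^-1 * jm u i c.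
have d1 : dm (b1 * u) = delta v.
  rewrite -scalerAl linearZ /= match_partM match_part_match // du mulmxA
    delta_mul_delta mul_deltaE.
  by rewrite eqxx mulr1 scalerA mulVf // scale1r.
have j1 : jm (b1 * u) = f *: delta v.
  rewrite -scalerAl linearZ /= ones_partM ones_part_match // match_part_match //
    !mul0mx add0r addr0 ju mulmxA.
  by rewrite delta_mul_delta scalerA.
have delta_linked : linked_mx cl (delta v : 'M[F]_n).
  by apply: linked_delta; rewrite linked_rp.
pose b2 := mk (- f *: delta v) (delta v); exists (b2 * b1).
rewrite -mulrA; apply: (coords_inj co).
  rewrite ones_partM d1 j1 ones_part_of // match_part_of // ones_part_vertex (negPf v0).
  rewrite -!scalemxAl -!scalemxAr mul_delta_mx delta_mul_delta.
  rewrite size_mxE eqxx clK (negPf v0) two0 scale0r !scaler0 add0r.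
  by rewrite scaleNr addrN.
by rewrite match_partM d1 match_part_of // match_part_vertex (negPf v0) mul_delta_mx.
Qed.

Lemma vertex_complete : complete_proj_indec (fun v => principal (E v)).
Proof.
apply: (@principal_complete A r.+1 vertex_idem nil_pred nil_pred0 nil_predD
  nil_predMl nil_pred3
  vertex_idem_idem vertex_notin_nil vertex_local vertex_hom_nil vertex_cover).
Qed.

End CharTwo.

(** * The endomorphism algebra as a quotient of a path algebra *)

Lemma mono_mul (Q : quiver) (F : fieldType) (p q u : qpath Q) :
  ptgt q = psrc p -> val u = (psrc q, (val q).2 ++ (val p).2) ->
  (<< 1 *g p >> : pathalg Q F) * << 1 *g q >> = << 1 *g u >>.
Proof.
move=> qp uE; apply: etrans (pmulUU 1 1 p q) _; rewrite (mul1r (1 : F)).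
case: (pcompP p q) => [w _ _ _ wE|]; last by rewrite qp eqxx.
by have -> : u = w by apply: val_inj; rewrite wE uE.
Qed.

Section PathRepresentation.
Variables (F : fieldType) (A : falgType F) (n r : nat) (cl : 'I_n -> 'I_r.+1).
Variables (rp : 'I_r.+1 -> 'I_n) (clK : cancel rp cl) (co : pair_coords cl A).
Hypothesis two0 : 2%:R = 0 :> F.
Implicit Types (x y a b : A) (i j : 'I_r) (v w : 'I_r.+1).

Let K : 'M[F]_n := size_mx F cl.
Notation jm := (ones_part co).
Notation dm := (match_part co).
Notation J := (ones_unit co).
Notation E := (vertex_idem rp co).
Notation Q := (lambda_quiver r).
Notation L := (pathalg (lambda_quiver r) F).
Implicit Types (p q : qpath Q).

(** The value of an arrow between v and w, one of which is 0, and also of the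
    path from v to w through 0. *)
Definition arrow_unit v w : A := J (rp v) (rp w).

Lemma match_part_arrow v w : dm (arrow_unit v w) = 0.
Proof. exact: match_part_ones. Qed.

Lemma ones_part_arrow v w : jm (arrow_unit v w) = delta_mx (rp v) (rp w).
Proof. exact: ones_part_ones. Qed.

Lemma arrow_unit_vertex v w : arrow_unit v w * E w = arrow_unit v w.
Proof.
apply: (coords_inj co);
  rewrite ?ones_part_Mvertex ?match_part_Mvertex // ?match_part_arrow ?mul0mx //.
by rewrite ones_part_arrow mul_delta_mx.
Qed.

Lemma vertex_arrow_unit v w : E v * arrow_unit v w = arrow_unit v w.
Proof.
apply: (coords_inj co);
  rewrite ?ones_part_vertexM ?match_part_vertexM // ?match_part_arrow ?mulmx0 //.
by rewrite ones_part_arrow mul_delta_mx.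
Qed.

(** The middle vertex contributes the size of its block, which is 2 = 0 unless
    the vertex is 0. This is the relation of the quiver. *)
Lemma arrow_unit_mul v z w :
  arrow_unit v z * arrow_unit z w = if z == ord0 then arrow_unit v w else 0.
Proof.
have Kz : K (rp z) (rp z) = (z == ord0)%:R.
  by rewrite size_mxE eqxx clK two0; case: eqP.
apply: (coords_inj co).
  rewrite ones_partM !ones_part_arrow !match_part_arrow mul0mx mulmx0 !addr0
    delta_mul_delta Kz.
  by case: eqP => _; rewrite ?scale1r ?ones_part_arrow // scale0r linear0.
by rewrite match_partM !match_part_arrow mul0mx; case: eqP => _;
  rewrite ?match_part_arrow ?linear0.
Qed.

Definition arrow_elt (a : arr Q) : A := arrow_unit (src a) (tgt a).

(** The factors appear in the order in which the arrows are traversed: paths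
    act on modules by right multiplication. Hence [path_ev] reverses products. *)
Definition walk_elt v (s : seq (arr Q)) : A := E v * \prod_(a <- s) arrow_elt a.

Definition path_elt (p : qpath Q) : A := walk_elt (val p).1 (val p).2.

Lemma walk_endr (v : vert Q) (s : seq (arr Q)) x :
  is_walk v s -> x * E v = x ->
  x * \prod_(a <- s) arrow_elt a * E (pend v s) = x * \prod_(a <- s) arrow_elt a.
Proof.
elim: s v x => [|a s IH] v x /=; first by rewrite big_nil mulr1.
case/andP=> /eqP <- w_s xE; rewrite big_cons mulrA [pend _ _]/(pend (tgt a) s).
by apply: IH => //; rewrite -mulrA arrow_unit_vertex.
Qed.

Lemma path_elt_tgt p : path_elt p * E (ptgt p) = path_elt p.
Proof. by apply: walk_endr; [exact: (valP p) | exact: vertex_idem_idem]. Qed.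

Lemma path_elt_src p : E (psrc p) * path_elt p = path_elt p.
Proof. by rewrite /path_elt /walk_elt mulrA vertex_idem_idem. Qed.

Lemma path_elt_comp p q :
  path_elt q * path_elt p = if Defs.pcomp p q is Some u then path_elt u else 0.
Proof.
case: (pcompP p q) => [u qp _ _ uE|qp].
  rewrite {3}/path_elt /walk_elt uE /= big_cat /= mulrA.
  by rewrite -[E _ * _]/(path_elt q) -[path_elt q in RHS]path_elt_tgt qp -mulrA.
rewrite -[path_elt q]path_elt_tgt -[path_elt p]path_elt_src mulrA.
by rewrite -[_ * E _ * E _]mulrA vertex_orth // (negPf qp) mulr0 mul0r.
Qed.

Definition path_ev : {linear L -> A} := malg_ev path_elt.

Lemma path_evU c p : path_ev << c *g p >> = c *: path_elt p.
Proof. exact: malg_evU. Qed.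

Lemma path_evM (f g : L) : path_ev (f * g) = path_ev g * path_ev f.
Proof.
pose m1 f g := path_ev (f * g); pose m2 f g := path_ev g * path_ev f.
have b1 : biadd m1.
  by split=> f1 f2 f3; rewrite /m1 ?(mulrDl, mulrDr) linearD.
have b2 : biadd m2.
  by split=> f1 f2 f3; rewrite /m2 linearD (mulrDl, mulrDr).
apply: (biadd_eq b1 b2 (@path_ind Q F)) => _ _ [c [p ->]] [e [q ->]].
apply: etrans (congr1 path_ev (pmulUU c e p q)) _.
apply: etrans _ (esym (f_equal2 *%R (path_evU e q) (path_evU c p))).
rewrite -scalerAl -scalerAr path_elt_comp scalerA mulrC;
  case: (Defs.pcomp p q) => [u|]; first exact: path_evU.
by rewrite linear0 scaler0.
Qed.

Lemma path_elt_triv v : path_elt (ptriv (v : vert Q)) = E v.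
Proof. by rewrite /path_elt /walk_elt big_nil mulr1. Qed.

Lemma path_ev1 : path_ev 1 = \sum_v E v.
Proof.
rewrite [1]/(pone Q F) linear_sum; apply: eq_bigr => v _.
by rewrite path_evU path_elt_triv scale1r.
Qed.

Definition vx (s : option 'I_r) : 'I_r.+1 := oapp (lift ord0) ord0 s.

Lemma vx_inj : injective vx.
Proof. by case=> [i|] [j|] //= /lift_inj ->. Qed.

(** The codes of the paths that survive the relations, with None for the
    vertex 0. The pair (s, t) stands for the shortest path from s to t if s or
    t is 0, and for the path through 0 otherwise, even if s = t; the code i on
    the right stands for the trivial path at the vertex of number i. *)
Definition code : Type := (option 'I_r * option 'I_r) + 'I_r.

Fact detour_walk i j : @is_walk Q (lift ord0 i) [:: inl i; inr j].
Proof. by rewrite /= !eqxx. Qed.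

Definition short (k : code) : qpath Q :=
  match k with
  | inl (None, None) => ptriv (ord0 : vert Q)
  | inl (Some i, None) => parr (inl i : arr Q)
  | inl (None, Some j) => parr (inr j : arr Q)
  | inl (Some i, Some j) => exist _ (lift ord0 i : vert Q, _) (detour_walk i j)
  | inr i => ptriv (lift ord0 i : vert Q)
  end.

Definition code_elt (k : code) : A :=
  match k with
  | inl (s, t) => arrow_unit (vx s) (vx t)
  | inr i => E (lift ord0 i)
  end.

Lemma path_elt_short k : path_elt (short k) = code_elt k.
Proof.
case: k => [[[i|] [j|]]|i]; rewrite ?path_elt_triv //.
- rewrite /path_elt /walk_elt !big_cons big_nil /= mulr1 /arrow_elt /=.
  by rewrite arrow_unit_mul vertex_arrow_unit.
- rewrite /path_elt /walk_elt !big_cons big_nil /= mulr1 /arrow_elt /=.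
  by rewrite vertex_arrow_unit.
rewrite /path_elt /walk_elt !big_cons big_nil /= mulr1 /arrow_elt /=.
by rewrite vertex_arrow_unit.
Qed.

Definition code_coord (k : code) x : F :=
  match k with
  | inl (s, t) => jm x (rp (vx s)) (rp (vx t))
  | inr i => dm x (rp (lift ord0 i)) (rp (lift ord0 i))
  end.

Lemma code_coord_linear k : linear (code_coord k : A -> F^o).
Proof. by case: k => [[s t]|i] c x y; rewrite /code_coord linearP !mxE. Qed.

Lemma code_coord0 k : code_coord k 0 = 0.
Proof. exact: (linear0 (mklin (code_coord_linear k))). Qed.

Lemma code_coord_elt k k' : code_coord k (code_elt k') = (k == k')%:R.
Proof.
have rv_inj := inj_comp (rp_inj clK) vx_inj.
have rl_inj := inj_comp (rp_inj clK) (@lift_inj _ ord0).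
case: k k' => [[s t]|i] [[s' t']|i'] /=.
- by rewrite ones_part_arrow mxE (inj_eq rv_inj s s') (inj_eq rv_inj t t').
- by rewrite ones_part_vertex // mxE.
- by rewrite match_part_arrow mxE.
by rewrite match_part_vertex //= mxE (inj_eq rl_inj i i') andbb.
Qed.

Lemma short_inj : injective short.
Proof.
move=> k k' /(congr1 path_elt); rewrite !path_elt_short.
move/(congr1 (code_coord k)); rewrite !code_coord_elt eqxx; case: eqP => // _.
by move/eqP; rewrite oner_eq0.
Qed.

(** A path with a factor 0 -> j -> 0 belongs to the ideal of relations, and is
    sent to 0. *)
Lemma backtrack_path (p : qpath Q) (s1 s2 : seq (arr Q)) j :
  (val p).2 = s1 ++ inr j :: inl j :: s2 ->
  path_elt p = 0 /\ (<< 1 *g p >> : L) \in lambda_ideal F r.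
Proof.
case: p => [[v s] /= wp] sE; subst s;
  have : is_walk v (s1 ++ [:: inr j, inl j & s2]) := wp.
rewrite is_walk_cat /= => /and3P[ws1 v0 /andP[_ ws2]].
have {}v0 : pend v s1 = ord0 by apply/esym/eqP.
pose p1 : qpath Q := exist _ (v, s1) ws1.
pose p2 : qpath Q := exist _ (ord0 : vert Q, s2) ws2.
split.
  rewrite /path_elt /walk_elt /= big_cat !big_cons /= /arrow_elt /=.
  by rewrite [arrow_unit _ _ * (_ * _)]mulrA arrow_unit_mul /= !mul0r !mulr0.
have wd : @is_walk Q ord0 [:: inr j; inl j] by rewrite /= !eqxx.
pose d : qpath Q := exist _ (ord0 : vert Q, _) wd.
have dE : alpha F j * beta F j = << 1 *g d >> by exact: mono_mul.
have wd1 : is_walk v (s1 ++ [:: inr j; inl j]).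
  by rewrite is_walk_cat ws1 v0.
pose d1 : qpath Q := exist _ (v, _) wd1.
have d1E : (<< 1 *g d >> : L) * << 1 *g p1 >> = << 1 *g d1 >>.
  by apply: mono_mul.
have pE : (<< 1 *g p2 >> : L) * << 1 *g d1 >> = << 1 *g exist _ (v, _) wp >>.
  apply: mono_mul; last by rewrite /= -catA.
  by rewrite /ptgt /= /pend map_cat last_cat.
rewrite -pE.
apply: (@ideal_mull _ _ (lambda_ideal F r)); rewrite -d1E.
apply: (@ideal_mulr _ _ (lambda_ideal F r)); rewrite -dE.
by apply/asboolP => I; apply; exists j.
Qed.

(** Arrows into and out of 0 alternate, so that a path of length at least 3
    contains a step 0 -> j followed by a step j -> 0; both belong to the same
    j because the path passes through j in between. *)
Lemma path_classify (p : qpath Q) :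
  (exists k, p = short k) \/
  (path_elt p = 0 /\ (<< 1 *g p >> : L) \in lambda_ideal F r).
Proof.
case: p => [[v s] /= wp].
case: s wp => [|a s] wp.
  left; case: (unliftP ord0 v) => [i|] vE; [exists (inr i)|exists (inl (None, None))];
  by apply: val_inj; rewrite /= vE.
have /= /andP[/eqP va ws] := wp.
case: s wp ws => [|b s] wp ws.
  left; case: a va wp ws => [i|j] /= va wp ws.
    by exists (inl (Some i, None)); apply: val_inj; rewrite /= va.
  by exists (inl (None, Some j)); apply: val_inj; rewrite /= va.
have /= /andP[/eqP ab ws'] := ws.
case: a va wp ws ab => [i|j] /= va wp ws ab; last first.
  case: b ab wp ws ws' => [j'|j'] //= /lift_inj -> wp ws ws'.
  by right; apply: (@backtrack_path _ [::] s j).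
case: b ab wp ws ws' => [//|j] /= _ wp ws.
case: s wp ws => [|c s] /= wp ws.
  by left; exists (inl (Some i, Some j)); apply: val_inj; rewrite /= va.
case/andP; case: c wp ws => [j'|j'] //= wp ws /eqP /lift_inj jj _; subst j'.
by right; apply: (@backtrack_path _ [:: inl i] s j).
Qed.

(** The images of the surviving paths are linearly independent, and all other
    paths are sent to 0; hence the coefficient of a surviving path can be read
    off the image. *)
Lemma code_coord_path_ev k (f : L) : code_coord k (path_ev f) = f@_(short k).
Proof.
pose c := mklin (code_coord_linear k); rewrite -[LHS]/(c (path_ev f)).
elim/path_ind: f => [|f g IHf IHg|_ [e [p ->]]].
- by rewrite !linear0 mcoeff0.
- by rewrite !linearD IHf IHg (mcoeffD (short k) f g).
rewrite path_evU linearZ (mcoeffU p e (short k)) -mulr_natr; congr (_ * _).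
rewrite /=; case: (path_classify p) => [[k' ->]|[p0 _]].
  by rewrite path_elt_short code_coord_elt (inj_eq short_inj) eq_sym.
rewrite p0 code_coord0; case: eqP => // pk; move/eqP: (code_coord_elt k k).
by rewrite -path_elt_short -pk p0 code_coord0 eqxx eq_sym oner_eq0.
Qed.

(** An element of the kernel has coefficient 0 at every surviving path, and
    the remaining paths belong to the ideal. *)
Lemma path_ev_ker (f : L) : (f \in lambda_ideal F r) = (path_ev f == 0).
Proof.
apply/idP/eqP => [|f0].
  pose ker : {pred L} := fun f => path_ev f == 0.
  have ker_zmod : zmod_closed ker.
    split=> [|g h /eqP g0 /eqP h0]; first by rewrite unfold_in linear0.
    by rewrite unfold_in linearB g0 h0 subrr.
  have ker_mull (a u : L) : u \in ker -> a * u \in ker.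
    by rewrite !unfold_in path_evM => /eqP ->; rewrite mul0r.
  have ker_mulr (a u : L) : u \in ker -> u * a \in ker.
    by rewrite !unfold_in path_evM => /eqP ->; rewrite mulr0.
  move/asboolP/(_ (Ideal ker_zmod ker_mull ker_mulr)).
  suff rel g : lambda_relation g -> g \in ker by move/(_ rel)/eqP.
  case=> j ->; apply/eqP; apply: etrans (path_evM _ _) _.
  apply: etrans (f_equal2 *%R (path_evU 1 _) (path_evU 1 _)) _.
  rewrite !scale1r.
  rewrite /path_elt /walk_elt !big_cons !big_nil !mulr1 /= /arrow_elt /=.
  by rewrite !vertex_arrow_unit // arrow_unit_mul.
rewrite (monalgE f); apply: rpred_sum => p _.
case: (path_classify p) => [[k ->]|[_ pI]].
  by rewrite -code_coord_path_ev f0 code_coord0 raddf0 rpred0.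
have -> : << f@_p *g p >> = f@_p *: (<< 1 *g p >> : L).
  by rewrite pscaleU mulr1.
by rewrite -mulr_algl; apply: ideal_mull.
Qed.

(** By [vertex_corner] each E_v x E_w is a combination of a J between
    representatives and, if v = w, of E_v; all of these are images of paths. *)
Lemma path_ev_surj x : (\sum_v E v) * x * (\sum_v E v) = x ->
  exists f : L, path_ev f = x.
Proof.
move=> <-; pose im y := exists f : L, path_ev f = y.
have im0 : im 0 by exists 0; rewrite linear0.
have imD y z : im y -> im z -> im (y + z).
  by move=> [f <-] [g <-]; exists (f + g); rewrite linearD.
have imZ c y : im y -> im (c *: y).
  by move=> [f <-]; exists (c *: f); rewrite linearZ.
have imE v : im (E v).
  exists << 1 *g ptriv (v : vert Q) >>; apply: etrans (path_evU 1 _) _.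
  by rewrite path_elt_triv scale1r.
have im_conn v w : im (arrow_unit v w).
  have vxE z : exists s, z = vx s.
    by case: (unliftP ord0 z) => [i|] ->; [exists (Some i) | exists None].
  have [s ->] := vxE v; have [t ->] := vxE w.
  exists << 1 *g short (inl (s, t)) >>; apply: etrans (path_evU 1 _) _.
  by rewrite path_elt_short scale1r.
rewrite mulr_suml mulr_suml; elim/big_ind: _ => // v _.
rewrite mulr_sumr; elim/big_ind: _ => // w _.
rewrite vertex_corner //; apply: imD; apply: imZ; last exact: imE.
exact: im_conn.
Qed.

Lemma basic_algebra_Lambda (m : nat) (P : 'I_m -> lmodType A) :
  complete_proj_indec P -> end_alg_iso (dirsum P) (Lambda F r).
Proof.
move=> completeP.
have orth v w : v != w -> E v * E w = 0 by move=> /negPf vw; rewrite vertex_orth // vw.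
have [f [f_inj f_im]] := dirsum_principal (vertex_idem_idem clK co) orth
  (vertex_complete clK co two0) completeP.
apply: (end_alg_iso_corner (mu := path_ev) _ f_inj _ f_im).
- rewrite mulr_suml; apply: eq_bigr => v _.
  rewrite mulr_sumr (bigD1 v) //= vertex_idem_idem // big1 ?addr0 // => w wv.
  by rewrite orth // eq_sym.
- exact: path_ev1.
- exact: path_evM.
- exact: path_ev_ker.
exact: path_ev_surj.
Qed.

End PathRepresentation.

(** * Blocks of a quasi-thin scheme *)

Section Relations.
Variables (d : nat) (X : finType) (S : scheme d X).
Implicit Types (i j l : 'I_d.+1) (y z w : X).

Definition rel_of y z : 'I_d.+1 := odflt ord0 [pick l | (y, z) \in S l].

Lemma mem_rel_of y z l : ((y, z) \in S l) = (rel_of y z == l).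
Proof.
have [/eqP covS trS _] := and3P (rel_partition S).
have uniqS a b : (y, z) \in S a -> (y, z) \in S b -> a = b.
  move=> ya yb; apply: (@rel_inj _ _ S).
  have imS e : S e \in [set S k | k : 'I_d.+1] by apply: imset_f.
  apply/eqP/negPn/negP => ab.
  move/trivIsetP/(_ _ _ (imS a) (imS b) ab): trS.
  by rewrite disjoint_subset => /subsetP/(_ _ ya); rewrite inE yb.
rewrite /rel_of; case: pickP => [e ye|none] /=.
  by apply/idP/eqP => [yl|<- //]; exact: uniqS ye yl.
have: (y, z) \in cover [set S k | k : 'I_d.+1] by rewrite covS inE.
by case/bigcupP => _ /imsetP[k _ ->]; rewrite none.
Qed.

Lemma rel_of_diag y z : (rel_of y z == ord0) = (y == z).
Proof. by rewrite -mem_rel_of rel_diag inE. Qed.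

(** Regularity in the form in which it is used: a triangle over the pair (y,
    z) can be transported to every other pair in the same relation. *)
Lemma rel_of_regular y z y' z' w : rel_of y z = rel_of y' z' ->
  exists w', rel_of y' w' = rel_of y w /\ rel_of w' z' = rel_of w z.
Proof.
move=> eyz; pose N (u : X * X) :=
  [set t | ((u.1, t) \in S (rel_of y w)) && ((t, u.2) \in S (rel_of w z))].
have eN : #|N (y, z)| = #|N (y', z')|.
  by apply: (@rel_regular _ _ S _ _ (rel_of y z)); rewrite mem_rel_of ?eyz.
have : (0 < #|N (y', z')|)%N.
  by rewrite -eN; apply/card_gt0P; exists w; rewrite inE /= !mem_rel_of !eqxx.
case/card_gt0P => w'; rewrite inE /= !mem_rel_of => /andP[/eqP ? /eqP ?].
by exists w'.
Qed.

Lemma rel_of_transp y z : rel_of z y = transp S (rel_of y z).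
Proof.
have [i' i'E] := rel_transpose S (rel_of y z).
rewrite /transp; case: pickP => [k /eqP kE|/(_ i')] /=; last by rewrite i'E eqxx.
by apply/eqP; rewrite -mem_rel_of kE inE /= mem_rel_of.
Qed.

Lemma rel_of_sym y z y' z' : rel_of y z = rel_of y' z' -> rel_of z y = rel_of z' y'.
Proof. by move=> e; rewrite !(rel_of_transp y) !(rel_of_transp y') e. Qed.

Lemma pnumE i j l y z : rel_of y z = l ->
  pnum S i j l = #|[set w | (rel_of y w == i) && (rel_of w z == j)]|.
Proof.
move=> yz; have yzl : (y, z) \in S l by rewrite mem_rel_of yz.
rewrite /pnum; case: pickP => [u ul|/(_ (y, z))]; last by rewrite yzl.
rewrite (rel_regular i j ul yzl); apply: eq_card => w.
by rewrite !inE /= !mem_rel_of.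
Qed.

Lemma valencyE i y : valency S i = #|[set z | rel_of y z == i]|.
Proof.
rewrite /valency (@pnumE _ _ _ y y); last by apply/eqP; rewrite rel_of_diag.
apply: eq_card => z; rewrite !inE [rel_of z y]rel_of_transp.
by case: eqP => // ->; rewrite eqxx.
Qed.

Lemma rel_of_onto i y : exists z, rel_of y z = i.
Proof.
have [_ _ S0] := and3P (rel_partition S).
have [u ui] : exists u, u \in S i.
  by apply/set0Pn; apply: contra S0 => /eqP <-; apply: imset_f.
case: u ui => a b; rewrite mem_rel_of => /eqP ab.
have eay : rel_of a a = rel_of y y.
  by transitivity (ord0 : 'I_d.+1); [|symmetry]; apply/eqP; rewrite rel_of_diag.
by have [z [zE _]] := rel_of_regular b eay; exists z; rewrite zE.
Qed.

Variable x : X.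

Definition blk y : 'I_d.+1 := rel_of x y.

Lemma block_row y y' z : blk y = blk y' ->
  exists z', blk z' = blk z /\ rel_of y' z' = rel_of y z.
Proof.
move=> yy'; have [z' [z'E zy]] := rel_of_regular z yy'.
by exists z'; split=> //; apply: rel_of_sym.
Qed.

Lemma block_col z z' y : blk z = blk z' ->
  exists y', blk y' = blk y /\ rel_of y' z' = rel_of y z.
Proof. exact: rel_of_regular. Qed.

Definition pt0 i : X := odflt x [pick y | blk y == i].
Definition pt1 i : X := odflt (pt0 i) [pick y | (blk y == i) && (y != pt0 i)].

Lemma blk_pt0 i : blk (pt0 i) = i.
Proof.
rewrite /pt0; case: pickP => [y /eqP //|none].
by have [z zE] := rel_of_onto i x; have := none z; rewrite /blk zE eqxx.
Qed.

Lemma blk_pt1 i : blk (pt1 i) = i.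
Proof.
by rewrite /pt1; case: pickP => [y /andP[/eqP]|] //= _; exact: blk_pt0.
Qed.

Hypothesis qtS : quasi_thin S.

Lemma block_points y : y = pt0 (blk y) \/ y = pt1 (blk y).
Proof.
have [->|y0] := eqVneq y (pt0 (blk y)); first by left; rewrite blk_pt0.
right; rewrite /pt1; case: pickP => [z /andP[zb z0]|/(_ y)] /=; last first.
  by rewrite eqxx y0.
have := qtS (blk y); rewrite (valencyE _ x); apply: contraTeq => yz.
have sub : z |: [set pt0 (blk y); y] \subset [set t | rel_of x t == blk y].
  by apply/subsetP=> t; rewrite !inE => /orP[|/orP[]] /eqP ->;
    rewrite -/(blk _) ?blk_pt0.
rewrite -ltnNge; apply: leq_trans (subset_leq_card sub).
by rewrite cardsU1 cards2 !inE negb_or z0 (eq_sym z) yz (eq_sym (pt0 _)) y0.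
Qed.

Lemma A2_pts i : (i \in A2 S) = (pt0 i != pt1 i).
Proof.
have bE : [set z | rel_of x z == i] = [set pt0 i; pt1 i].
  apply/setP=> z; rewrite !inE -/(blk z); apply/eqP/orP => [zi|[]/eqP ->].
  - by case: (block_points z) => ->; rewrite zi eqxx; [left|right].
  - exact: blk_pt0.
  exact: blk_pt1.
by rewrite inE (valencyE _ x) bE cards2; case: (pt0 i != pt1 i).
Qed.

Definition mixed i j : bool := rel_of (pt0 i) (pt0 j) != rel_of (pt0 i) (pt1 j).

(** By [block_row] and [block_col], any two rows of the table of relations of
    a block contain the same relations, and so do any two columns. For a table
    with at most two rows and columns this leaves the constant tables and the
    two-by-two tables with one relation on each diagonal. *)
Lemma block_cases i j :
  [/\ ~~ mixed i j, rel_of (pt0 i) (pt1 j) = rel_of (pt0 i) (pt0 j),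
     rel_of (pt1 i) (pt0 j) = rel_of (pt0 i) (pt0 j)
       & rel_of (pt1 i) (pt1 j) = rel_of (pt0 i) (pt0 j)]
  \/ [/\ mixed i j, rel_of (pt1 i) (pt0 j) = rel_of (pt0 i) (pt1 j)
     & rel_of (pt1 i) (pt1 j) = rel_of (pt0 i) (pt0 j)].
Proof.
have inb k z : blk z = k -> z = pt0 k \/ z = pt1 k.
  by move=> <-; exact: block_points.
have b01 k : blk (pt0 k) = blk (pt1 k) by rewrite blk_pt0 blk_pt1.
have row z : blk z = j -> rel_of (pt1 i) z = rel_of (pt0 i) (pt0 j)
    \/ rel_of (pt1 i) z = rel_of (pt0 i) (pt1 j).
  move=> zj; have [t [tj <-]] := block_row z (esym (b01 i)).
  by case: (inb j t) => [|->|->]; [rewrite tj | left | right].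
have row' z : blk z = j -> rel_of (pt0 i) z = rel_of (pt1 i) (pt0 j)
    \/ rel_of (pt0 i) z = rel_of (pt1 i) (pt1 j).
  move=> zj; have [t [tj <-]] := block_row z (b01 i).
  by case: (inb j t) => [|->|->]; [rewrite tj | left | right].
have col y : blk y = i -> rel_of y (pt1 j) = rel_of (pt0 i) (pt0 j)
    \/ rel_of y (pt1 j) = rel_of (pt1 i) (pt0 j).
  move=> yi; have [t [ti <-]] := block_col y (esym (b01 j)).
  by case: (inb i t) => [|->|->]; [rewrite ti | left | right].
have := row _ (blk_pt0 j); have := row _ (blk_pt1 j).
have := row' _ (blk_pt0 j); have := row' _ (blk_pt1 j).
have := col _ (blk_pt0 i); have := col _ (blk_pt1 i).
rewrite /mixed.
case: (rel_of (pt0 i) (pt0 j) =P rel_of (pt0 i) (pt1 j)) => [<- | ab] /=.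
  by move=> _ _ _ _ [->|->] [->|->]; left.
by move=> c1 c2 c3 c4 c5 c6; right; split=> //; intuition congruence.
Qed.

Lemma mixed_points i j y z y' z' : blk y = i -> blk y' = i -> blk z = j -> blk z' = j ->
  ~~ mixed i j -> rel_of y z = rel_of y' z'.
Proof.
move=> <- y'i <- z'j mij.
have [[_ e1 e2 e3]|[mij' _ _]] := block_cases (blk y) (blk z);
  last by rewrite mij' in mij.
by case: (block_points y) => ->; case: (block_points z) => ->;
   case: (block_points y') => ->; case: (block_points z') => ->;
   rewrite ?y'i ?z'j ?blk_pt0 ?blk_pt1 ?e1 ?e2 ?e3.
Qed.

Lemma mixed_thick i j : mixed i j -> (i \in A2 S) && (j \in A2 S).
Proof.
move=> mij; rewrite !A2_pts; apply/andP; split; apply: contraTneq (mij) => e.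
  have [[]|[_ e1 e2]] := block_cases i j; first by move=> /negbTE ->.
  by rewrite /mixed negbK e e2 -e.
by rewrite /mixed e eqxx.
Qed.

Lemma mixed_sym i j : mixed i j = mixed j i.
Proof.
suff half a b : mixed a b -> mixed b a by apply/idP/idP; exact: half.
move=> mab; have [[]|[_ e1 _]] := block_cases a b; first by rewrite mab.
by apply: contraNN (mab) => /eqP/rel_of_sym e; rewrite e e1.
Qed.

Lemma mixed_refl i : i \in A2 S -> mixed i i.
Proof.
rewrite A2_pts; apply: contraNN => /eqP.
have -> : rel_of (pt0 i) (pt0 i) = ord0 by apply/eqP; rewrite rel_of_diag.
by move/esym/eqP; rewrite rel_of_diag.
Qed.

Lemma mem_rprod a b l :
  reflect (exists y z, [/\ blk y = a, blk z = b & rel_of y z = l])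
    (l \in rprod S (transp S a) b).
Proof.
rewrite inE; apply: (iffP exists_inP) => [[a' /set1P ->] | [y [z [ya zb yz]]]].
  case/exists_inP=> b' /set1P -> lt0; have [u uE] := rel_of_onto l x.
  move: lt0; rewrite (pnumE _ _ uE) => /card_gt0P[w]; rewrite inE.
  case/andP=> /eqP xw /eqP wu.
  have wx : rel_of w x = rel_of x (pt0 a).
    by apply: rel_of_sym; rewrite xw rel_of_transp -/(blk _) blk_pt0.
  have [y [xy yz]] := rel_of_regular x (etrans wu (esym (blk_pt0 b))).
  exists y, (pt0 b); rewrite blk_pt0 yz uE; split=> //.
  by rewrite /blk xy wx; exact: blk_pt0.
exists (transp S a); rewrite ?inE //; apply/exists_inP; exists b; rewrite ?inE //.
rewrite (pnumE _ _ yz); apply/card_gt0P; exists x.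
by rewrite inE rel_of_transp -!/(blk _) ya zb !eqxx.
Qed.

Lemma card_rprod a b : #|rprod S (transp S a) b| = (mixed a b).+1.
Proof.
suff -> : rprod S (transp S a) b = [set rel_of (pt0 a) (pt0 b); rel_of (pt0 a) (pt1 b)].
  by rewrite cards2.
apply/setP=> l; apply/mem_rprod/idP => [[y [z [ya zb <-]]]|].
  have [[mab _ _ _]|[_ e1 e2]] := block_cases a b.
    by rewrite (mixed_points ya (blk_pt0 a) zb (blk_pt0 b)) // !inE eqxx.
  rewrite !inE; case: (block_points y); case: (block_points z);
    by rewrite ya zb => -> ->; rewrite ?e1 ?e2 eqxx ?orbT.
rewrite !inE => /orP[] /eqP ->.
  by exists (pt0 a), (pt0 b); rewrite !blk_pt0.
by exists (pt0 a), (pt1 b); rewrite blk_pt0 blk_pt1.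
Qed.

Lemma good_pairP a b : good_pair S a b <-> mixed a b.
Proof.
split=> [[_ _]|mab]; first by rewrite card_rprod; case: mixed.
have /andP[? ?] := mixed_thick mab; split=> //.
by rewrite card_rprod mab.
Qed.

Lemma pnum_mixed i l : mixed i l -> pnum S i (rel_of (pt0 i) (pt0 l)) l = 1%N.
Proof.
move=> mil; rewrite (pnumE _ _ (blk_pt0 l)); apply: (@eq_card1 _ (pt0 i)) => w.
rewrite !inE -/(blk _); apply/andP/eqP => [[/eqP wi /eqP wl]|->]; last first.
  by rewrite blk_pt0 !eqxx.
case: (block_points w); rewrite wi // => wE; move: wl; rewrite wE.
have [[]|[_ -> _]] := block_cases i l; first by rewrite mil.
by move/eqP; rewrite eq_sym -/(mixed i l) /mixed; move: mil;
  rewrite /mixed => /negbTE ->.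
Qed.

Lemma mixed_pnum i j l : i \in A2 S -> pnum S i j l = 1%N -> mixed i l.
Proof.
move=> i2; rewrite (pnumE _ _ (blk_pt0 l)); apply: contra_eqT => nil.
have cst w : blk w = i -> rel_of w (pt0 l) = rel_of (pt0 i) (pt0 l).
  by move=> wi; apply: mixed_points nil; rewrite ?blk_pt0.
have [e|ne] := eqVneq (rel_of (pt0 i) (pt0 l)) j; last first.
  rewrite (_ : [set w | _] = set0) ?cards0 //; apply/setP=> w; rewrite !inE -/(blk _).
  by apply/andP => -[/eqP /cst -> /eqP e]; rewrite e eqxx in ne.
rewrite (_ : [set w | _] = [set w | rel_of x w == i]).
  by rewrite -valencyE; move: i2; rewrite inE => /eqP ->.
apply/setP=> w; rewrite !inE -/(blk _); case: eqP => //= /cst ->.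
by rewrite e eqxx.
Qed.

(** By [pnum_mixed] and [mixed_pnum] the condition p = 1 on the steps of a bad
    pair says that each step is a mixed block, and the condition on its ends
    says that they do not form a mixed block; so ~ relates the ends of all
    nonempty chains of mixed blocks. Chains of length 0 add nothing, because
    diagonal blocks of two points are mixed. *)
Lemma simP a b : sim S a b <-> a \in A2 S /\ connect mixed a b.
Proof.
have A2E i : (i \in A2 S) = (valency S i == 2) by rewrite inE.
split=> [[/good_pairP mab|[n [i [j [l [chain _ step -> ->]]]]]]|
         [a2 /connectP[s s_path ->]]].
- by case/andP: (mixed_thick mab) => a2 _; split=> //; exact: connect1.
- have mil c : (c <= n)%N -> mixed (i c) (l c).
    by case/chain=> /eqP i2 _ p1E; apply: mixed_pnum p1E; rewrite A2E.
  split; first by rewrite A2E; case: (chain 0 isT) => ->.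
  suff con c : (c <= n)%N -> connect mixed (i 0) (l c) by exact: con.
  elim: c => [|c IH] cn; first exact/connect1/mil.
  apply: connect_trans (IH (ltnW cn)) _; rewrite (step c cn).
  exact/connect1/mil.
have [mal|mal] := boolP (mixed a (last a s)); first by left; exact/good_pairP.
right; have s0 : (0 < size s)%N.
  by case: s s_path mal => //= _; rewrite mixed_refl.
pose i c := nth a (a :: s) c; pose l c := nth a s c.
have mil c : (c <= (size s).-1)%N -> mixed (i c) (l c).
  by move=> cs; move/(pathP a): s_path; apply; rewrite -(prednK s0) ltnS.
exists (size s).-1, i, (fun c => rel_of (pt0 (i c)) (pt0 (l c))), l; split=> //.
- move=> c /mil mc; have /andP[] := mixed_thick mc; rewrite !A2E => /eqP ? /eqP ?.
  by split=> //; exact: pnum_mixed.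
- by rewrite card_rprod /l nth_last; move: mal => /negbTE; case: (s) s0 => //= ? ? _ ->.
by rewrite /l nth_last; case: (s) s0.
Qed.

End Relations.

Section Classes.
Variables (d : nat) (X : finType) (S : scheme d X) (x : X).
Hypothesis qtS : quasi_thin S.
Implicit Types (i j l : 'I_d.+1).

Notation r := #|sim_classes S|.
Notation mixed := (mixed S x).
Let simb i j : bool := `[< sim S i j >].

Lemma simbP i j : simb i j = (i \in A2 S) && connect mixed i j.
Proof.
by apply/asboolP/andP => /(simP x qtS).
Qed.

Lemma sim_equiv : {in A2 S & &, equivalence_rel simb}.
Proof.
have sym : connect_sym mixed.
  by apply: sym_connect_sym => i j; apply: mixed_sym.
move=> i j l iA jA lA; rewrite !simbP iA jA lA /= connect0; split=> // ij.
exact: same_connect ij _.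
Qed.

Lemma classes_partition : partition (sim_classes S) (A2 S).
Proof. exact: equivalence_partitionP sim_equiv. Qed.

Definition class_of (k : 'I_r) : {set 'I_d.+1} := enum_val k.

(** The label of the class of i, and 0 if the block of i has one point. *)
Definition class_ix i : 'I_r.+1 :=
  oapp (lift ord0) ord0 [pick k | i \in class_of k].

Lemma class_of_uniq k k' i : i \in class_of k -> i \in class_of k' -> k = k'.
Proof.
have /and3P[_ tri _] := classes_partition => ik ik'.
apply: enum_val_inj; transitivity (pblock (sim_classes S) i).
  exact/esym/(def_pblock tri (enum_valP k) ik).
exact: (def_pblock tri (enum_valP k') ik').
Qed.

Lemma class_ixP i k : i \in class_of k -> class_ix i = lift ord0 k.
Proof.
move=> ik; rewrite /class_ix; case: pickP => [k' ik'|/(_ k)] /=; last by rewrite ik.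
by rewrite (class_of_uniq ik ik').
Qed.

Lemma class_exists i : i \in A2 S -> exists2 k, i \in class_of k &
  class_of k = pblock (sim_classes S) i.
Proof.
have /and3P[/eqP covA _ _] := classes_partition.
rewrite -covA => iA; have iP := pblock_mem iA.
exists (enum_rank_in iP (pblock (sim_classes S) i)); rewrite /class_of enum_rankK_in //.
by rewrite mem_pblock.
Qed.

Lemma class_sub k i : i \in class_of k -> i \in A2 S.
Proof.
have /and3P[/eqP <- _ _] := classes_partition => ik.
by apply/bigcupP; exists (class_of k) => //; exact: enum_valP.
Qed.

Lemma class_ix_thick i : (class_ix i != ord0) = (i \in A2 S).
Proof.
apply/idP/idP => [|/class_exists[k /class_ixP -> _] //].
by rewrite /class_ix; case: pickP => // k /class_sub.
Qed.

Lemma class_ix_linked i j : linked class_ix i j = (i \in A2 S) && connect mixed i j.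
Proof.
rewrite linkedE class_ix_thick -simbP; have [iA|iA] := boolP (i \in A2 S); last first.
  by rewrite andbF simbP (negPf iA).
rewrite andbT; have [k ik kE] := class_exists iA; rewrite (class_ixP ik).
have [jA|jA] := boolP (j \in A2 S); last first.
  have /negbTE -> : lift ord0 k != class_ix j.
    by apply: contra jA => /eqP kj; rewrite -class_ix_thick -kj.
  apply/esym/negbTE; rewrite simbP iA /=; apply: contra jA => /connectP[s].
  case/lastP: s => [_ -> //|s z]; rewrite rcons_path last_rcons => /andP[_ m] ->.
  by case/andP: (mixed_thick qtS m).
rewrite -(pblock_equivalence_partition sim_equiv iA jA) -kE.
apply/eqP/idP => [|jk]; last by rewrite (class_ixP jk).
have [k' jk' _] := class_exists jA; rewrite (class_ixP jk') => /lift_inj ->.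
exact: jk'.
Qed.

Definition class_rep (v : 'I_r.+1) : 'I_d.+1 :=
  if unlift ord0 v is Some k then odflt ord0 [pick i in class_of k] else ord0.

Lemma class_repK : cancel class_rep class_ix.
Proof.
move=> v; rewrite /class_rep; case: unliftP => [k ->|->].
  case: pickP => [i /class_ixP //|none] /=.
  have /and3P[_ _ /negP[]] := classes_partition.
  rewrite -(_ : class_of k = set0) ?enum_valP //.
  by apply/setP=> i; rewrite inE none.
apply/eqP/negPn; rewrite class_ix_thick (A2_pts x qtS) negbK.
have p x0 : blk S x x0 = ord0 -> x = x0 by move/eqP; rewrite rel_of_diag => /eqP.
by rewrite -(p _ (blk_pt0 S x ord0)) -(p _ (blk_pt1 S x ord0)).
Qed.

End Classes.

(** * The Terwilliger algebra in block coordinates *)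

Section Matrices.
Variables (F : fieldType) (d : nat) (X : finType) (S : scheme d X) (x : X).
Hypothesis qtS : quasi_thin S.
Implicit Types (i j l : 'I_d.+1) (y z : X).

Notation mixed := (mixed S x).
Notation cl := (@class_ix d X S).
Notation T := (terwilliger F S x).
Notation blk := (blk S x).
Notation pt0 := (pt0 S x).
Notation pt1 := (pt1 S x).
Notation N := (#|X|.-1.+1).
Implicit Types (f g : 'M[F]_d.+1) (M : 'M[F]_N) (a b c : 'I_N).

(** The first points of all blocks lie on one side, the second points on the
    other; a matching block matches equal sides. *)
Definition side y : bool := y == pt0 (blk y).

Definition point_ix y : 'I_N := odflt ord0 [pick a | pt x a == y].

Lemma point_ixK y : pt x (point_ix y) = y.
Proof.
rewrite /point_ix; case: pickP => [a /eqP //|none].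
by have [h _ hK] := pt_bij x; have := none (h y); rewrite hK eqxx.
Qed.

Definition mxof (h : X -> X -> F) : 'M[F]_N := \matrix_(a, b) h (pt x a) (pt x b).

Definition entry M y z : F := M (point_ix y) (point_ix z).

Lemma entryE h y z : entry (mxof h) y z = h y z.
Proof. by rewrite /entry mxE !point_ixK. Qed.

Lemma mxofM (h h' : X -> X -> F) :
  mxof h *m mxof h' = mxof (fun y z => \sum_w h y w * h' w z).
Proof.
apply/matrixP=> a b; rewrite !mxE (reindex (pt x)) /=; last first.
  exact: onW_bij (pt_bij x).
by apply: eq_bigr => c _; rewrite !mxE.
Qed.

Definition blockf f g y z : F :=
  f (blk y) (blk z) + g (blk y) (blk z) * (side y == side z)%:R.
Definition block_mat f g : 'M[F]_N := mxof (blockf f g).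

(** The matching part vanishes at (pt0 i, pt1 j): these points lie on
    different sides, or else j has a one-point block and is linked to nothing. *)
Definition ones_coord M : 'M[F]_d.+1 := \matrix_(i, j) entry M (pt0 i) (pt1 j).
Definition match_coord M : 'M[F]_d.+1 :=
  \matrix_(i, j) (entry M (pt0 i) (pt0 j) - entry M (pt0 i) (pt1 j)).

Lemma side_pt0 i : side (pt0 i).
Proof. by rewrite /side blk_pt0. Qed.

Lemma side_pt1 i : side (pt1 i) = (i \notin A2 S).
Proof. by rewrite /side blk_pt1 (A2_pts x qtS) negbK eq_sym. Qed.

Lemma linked_thick i j : linked cl i j -> (i \in A2 S) && (j \in A2 S).
Proof. by case/andP=> /eqP ij i0; rewrite -!class_ix_thick // -ij i0. Qed.

Lemma ones_coord_block f g : linked_mx cl g -> ones_coord (block_mat f g) = f.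
Proof.
move=> lg; apply/matrixP=> i j;
  rewrite mxE entryE /blockf blk_pt0 blk_pt1 side_pt0 side_pt1.
have [ij|/lg ->] := boolP (linked cl i j); last by rewrite mul0r addr0.
by have /andP[_ ->] := linked_thick ij; rewrite mulr0 addr0.
Qed.

Lemma match_coord_block f g : linked_mx cl g -> match_coord (block_mat f g) = g.
Proof.
move=> lg; apply/matrixP=> i j;
  rewrite mxE !entryE /blockf !blk_pt0 blk_pt1 !side_pt0 side_pt1.
have [ij|/lg ->] := boolP (linked cl i j); last by rewrite !mul0r subrr.
by have /andP[_ ->] := linked_thick ij; rewrite mulr0 mulr1 addr0 addrC addKr.
Qed.

Lemma sum_blocks (h : X -> F) :
  \sum_y h y = \sum_i (h (pt0 i) + (if i \in A2 S then h (pt1 i) else 0)).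
Proof.
rewrite (partition_big blk predT) //=; apply: eq_bigr => i _.
rewrite (bigD1 (pt0 i)) ?blk_pt0 //=; congr (_ + _).
rewrite (A2_pts x qtS); case: ifP => [p01|/negbFE/eqP p01].
  rewrite (big_pred1 (pt1 i)) // => y /=; apply/andP/eqP => [[/eqP yi y0]|->].
    by case: (block_points x qtS y) y0; rewrite yi => -> //; rewrite eqxx.
  by rewrite blk_pt1 eqxx eq_sym p01.
rewrite big_pred0 // => y /=; apply/negP => /andP[/eqP yi y0].
by case: (block_points x qtS y) y0; rewrite yi => ->; rewrite -?p01 eqxx.
Qed.

Lemma block_matM f g f' g' : linked_mx cl g -> linked_mx cl g' ->
  block_mat f g *m block_mat f' g' =
  block_mat (f *m size_mx F cl *m f' + g *m f' + f *m g') (g *m g').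
Proof.
move=> lg lg'; rewrite mxofM; congr mxof; apply/funext => y; apply/funext => z.
rewrite sum_blocks /blockf !mxE -!big_split /= mulr_suml -big_split /=.
apply: eq_bigr => k _; rewrite !blk_pt0 !blk_pt1 side_pt0 side_pt1.
have -> : (f *m size_mx F cl) (blk y) k =
    f (blk y) k * (if k \in A2 S then 2%:R else 1).
  rewrite mul_mx_diag !mxE -class_ix_thick //; by case: eqP.
have [kA|kA] := boolP (k \in A2 S); last first.
  rewrite addr0 mulr1.
  rewrite (lg _ k) ?(lg' k) ?(mul0r, mulr0, addr0) //.
    by apply: contra kA => /linked_thick /andP[].
  by apply: contra kA => /linked_thick /andP[].
by case: (side y); case: (side z) => /=; ring.
Qed.

Lemma linked_mxM g g' : linked_mx cl g -> linked_mx cl g' -> linked_mx cl (g *m g').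
Proof.
move=> lg lg' i j ij; rewrite mxE big1 // => k _.
have [ik|/lg ->] := boolP (linked cl i k); last by rewrite mul0r.
rewrite lg' ?mulr0 //; apply: contra ij.
by case/andP: ik => /eqP ik i0; rewrite !linkedE -ik i0.
Qed.

Definition linked_part g : 'M[F]_d.+1 :=
  \matrix_(i, j) (if linked cl i j then g i j else 0).

Lemma linked_partP g : linked_mx cl (linked_part g).
Proof. by move=> i j /negbTE ij; rewrite mxE ij. Qed.

Lemma linked_part_id g : linked_mx cl g -> linked_part g = g.
Proof.
by move=> lg; apply/matrixP=> i j; rewrite mxE; case: ifPn => // /lg ->.
Qed.

Lemma block_map_linear :
  linear (fun fg : 'M[F]_d.+1 * 'M[F]_d.+1 =>
    block_mat fg.1 (linked_part fg.2) : MX F X).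
Proof.
move=> s [f g] [f' g']; apply/matrixP=> a b; rewrite !mxE /blockf /= !mxE.
by case: ifP => _; ring.
Qed.

Definition block_space : {vspace MX F X} := limg (linfun (mklin block_map_linear)).

Lemma block_spaceP M :
  reflect (exists f g, linked_mx cl g /\ M = block_mat f g) (M \in block_space).
Proof.
apply: (iffP memv_imgP) => [[[f g] _ ->]|[f [g [lg ->]]]].
  by exists f, (linked_part g); rewrite lfunE; split=> //; exact: linked_partP.
by exists (f, g); rewrite ?memvf // lfunE /= linked_part_id.
Qed.

Lemma side_point y : y = if side y then pt0 (blk y) else pt1 (blk y).
Proof.
case: ifPn => [/eqP //|sy]; case: (block_points x qtS y) => // /eqP.
by rewrite -/(side y) (negPf sy).
Qed.

(** The two alternatives of [block_cases], for the entries of a matrix. *)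
Lemma mem_block_space (h : X -> X -> F) :
  (forall i j,
     [/\ h (pt0 i) (pt1 j) = h (pt0 i) (pt0 j), h (pt1 i) (pt0 j) = h (pt0 i) (pt0 j)
       & h (pt1 i) (pt1 j) = h (pt0 i) (pt0 j)]
     \/ [/\ linked cl i j, h (pt1 i) (pt0 j) = h (pt0 i) (pt1 j)
          & h (pt1 i) (pt1 j) = h (pt0 i) (pt0 j)]) ->
  mxof h \in block_space.
Proof.
move=> hP; apply/block_spaceP.
exists (\matrix_(i, j) h (pt0 i) (pt1 j)).
exists (\matrix_(i, j) (h (pt0 i) (pt0 j) - h (pt0 i) (pt1 j))); split.
  by move=> i j ij; rewrite mxE; case: (hP i j) => [[-> _ _]|[]];
    rewrite ?subrr // (negPf ij).
congr mxof; apply/funext => y; apply/funext => z; rewrite /blockf !mxE.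
rewrite {1}(side_point y) {1}(side_point z).
by case: (hP (blk y) (blk z)) => [[e1 e2 e3]|[_ e2 e3]]; case: (side y); case: (side z);
   rewrite /= ?e1 ?e2 ?e3; ring.
Qed.

Lemma scalar_blocks (h : 'I_d.+1 -> F) :
  mxof (fun y z => (y == z)%:R * h (blk y)) \in block_space.
Proof.
apply: mem_block_space => i j; have [->|ij] := eqVneq i j; last first.
  have ne y z : blk y = i -> blk z = j -> (y == z) = false.
    by move=> yi zj; apply: contraNF ij => /eqP yz; rewrite -yi -zj yz.
  by left; rewrite !ne ?blk_pt0 ?blk_pt1 ?mul0r.
have [jA|jA] := boolP (j \in A2 S); last first.
  by move: jA; rewrite (A2_pts x qtS) negbK => /eqP <-; left.
right; rewrite (class_ix_linked x qtS) jA connect0 !blk_pt0 !blk_pt1 !eqxx.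
by split=> //; rewrite eq_sym.
Qed.

Lemma gen_adj l : adj F S x l = mxof (fun y z => (rel_of S y z == l)%:R).
Proof. by apply/matrixP=> a b; rewrite !mxE mem_rel_of. Qed.

Lemma gen_dual l : dual_idem F S x l = mxof (fun y z => (y == z)%:R * (blk y == l)%:R).
Proof.
apply/matrixP=> a b; rewrite /dual_idem summxE mxE (inj_eq (bij_inj (pt_bij x))).
have [<-|ab] := eqVneq a b; last first.
  rewrite mul0r big1 // => c _; rewrite mxE; case: eqP => //= ac.
  by case: eqP => // bc; rewrite ac bc eqxx in ab.
have -> : (blk (pt x a) == l) = ((x, pt x a) \in S l) by rewrite mem_rel_of.
rewrite mul1r; case: (boolP ((x, pt x a) \in S l)) => al.
  rewrite (bigD1 a) //= mxE !eqxx big1 ?addr0 // => c /andP[_ ca].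
  by rewrite mxE eq_sym (negPf ca).
rewrite big1 // => c xc; rewrite mxE; case: eqP => // e.
by move: al; rewrite e xc.
Qed.

(** The matrices in block form are closed under products by [block_matM], and
    contain the generators and the identity. *)
Lemma terwilliger_sub : (T <= block_space)%VS.
Proof.
have gens :
    (<<[seq adj F S x i | i : 'I_d.+1] ++ [seq dual_idem F S x i | i : 'I_d.+1]>>
      <= block_space)%VS.
  apply/span_subvP => M; rewrite mem_cat => /orP[] /mapP[l _ ->].
    rewrite gen_adj; apply: mem_block_space => i j.
    have [[_ -> -> ->]|[mij -> ->]] := block_cases x qtS i j; first by left.
    right; split=> //; rewrite (class_ix_linked x qtS) (connect1 mij) andbT.
    by case/andP: (mixed_thick qtS mij).
  by rewrite gen_dual; exact: (scalar_blocks (fun i => (i == l)%:R)).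
apply: agenv_sub_modl.
  rewrite -memvE.
  have -> : (1 : MX F X) = mxof (fun y z => (y == z)%:R * 1).
    by apply/matrixP=> a b; rewrite !mxE (inj_eq (bij_inj (pt_bij x))) mulr1.
  exact: (scalar_blocks (fun=> 1)).
apply: subv_trans (prodvS gens (subvv _)) _; apply/prodvP => M M'.
case/block_spaceP => f [g [lg ->]] /block_spaceP[f' [g' [lg' ->]]].
apply/block_spaceP; rewrite [_ * _]block_matM //; do 2 eexists; split=> //.
exact: linked_mxM.
Qed.

Lemma adj_T l : adj F S x l \in T.
Proof.
apply: (subvP (sub_agenv _)); apply: memv_span; rewrite mem_cat.
by rewrite map_f // mem_enum.
Qed.

Lemma dual_T l : dual_idem F S x l \in T.
Proof.
apply: (subvP (sub_agenv _)); apply: memv_span; rewrite mem_cat orbC.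
by rewrite map_f // mem_enum.
Qed.

Lemma diag_mul (u : X -> F) (h : X -> X -> F) :
  mxof (fun y z => (y == z)%:R * u y) *m mxof h = mxof (fun y z => u y * h y z).
Proof.
rewrite mxofM; congr mxof; apply/funext => y; apply/funext => z.
rewrite (bigD1 y) //= eqxx mul1r big1 ?addr0 // => w wy.
by rewrite eq_sym (negPf wy) !mul0r.
Qed.

Lemma mul_diag (u : X -> F) (h : X -> X -> F) :
  mxof h *m mxof (fun y z => (y == z)%:R * u y) = mxof (fun y z => h y z * u z).
Proof.
rewrite mxofM; congr mxof; apply/funext => y; apply/funext => z.
rewrite (bigD1 z) //= eqxx mul1r big1 ?addr0 // => w wz.
by rewrite (negPf wz) mul0r mulr0.
Qed.

Lemma cut_T i j (h : X -> X -> F) : mxof h \in T ->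
  mxof (fun y z => (blk y == i)%:R * h y z * (blk z == j)%:R) \in T.
Proof.
move=> hT.
suff -> : mxof (fun y z => (blk y == i)%:R * h y z * (blk z == j)%:R) =
    (dual_idem F S x i : MX F X) * mxof h * dual_idem F S x j.
  by apply: memvM; [apply: memvM => //|]; exact: dual_T.
rewrite !gen_dual; apply/esym.
apply: etrans (congr1 (fun M : 'M[F]_N => M *m _) (diag_mul _ _)) _.
exact: mul_diag.
Qed.

Lemma block_J_T i j : block_mat (delta_mx i j) 0 \in T.
Proof.
have -> : block_mat (delta_mx i j) 0 =
    mxof (fun y z => (blk y == i)%:R * 1 * (blk z == j)%:R).
  congr mxof; apply/funext => y; apply/funext => z; rewrite /blockf !mxE.
  by rewrite mul0r addr0 mulr1 -natrM mulnb.
apply: cut_T.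
have -> : mxof (fun _ _ => 1) = \sum_l adj F S x l.
  apply/matrixP=> a b; rewrite summxE mxE (bigD1 (rel_of S (pt x a) (pt x b))) //=.
  rewrite mxE mem_rel_of eqxx big1 ?addr0 // => l ne.
  by rewrite mxE mem_rel_of eq_sym (negPf ne).
by apply: memv_suml => l _; exact: adj_T.
Qed.

Lemma mixed_linked i j : mixed i j -> linked cl i j.
Proof.
move=> mij; rewrite (class_ix_linked x qtS) (connect1 mij) andbT.
by case/andP: (mixed_thick qtS mij).
Qed.

(** In a mixed block the relation of the two first points is the matching
    itself. *)
Lemma block_D_mixed i j : mixed i j -> block_mat 0 (delta_mx i j) \in T.
Proof.
move=> mij; pose l := rel_of S (pt0 i) (pt0 j).
have -> : block_mat 0 (delta_mx i j) =
    mxof (fun y z => (blk y == i)%:R * (rel_of S y z == l)%:R * (blk z == j)%:R).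
  congr mxof; apply/funext => y; apply/funext => z; rewrite /blockf !mxE add0r.
  have [yi|] := eqVneq (blk y) i; last by rewrite !mul0r.
  have [zj|] := eqVneq (blk z) j; last by rewrite mul0r mulr0.
  rewrite !mul1r mulr1; congr (_%:R).
  rewrite [in RHS](side_point y) [in RHS](side_point z).
  rewrite yi zj /l.
  have [[]|[_ e2 e3]] := block_cases x qtS i j; first by rewrite mij.
  have ne : rel_of S (pt0 i) (pt1 j) == rel_of S (pt0 i) (pt0 j) = false.
    by rewrite eq_sym; apply/negbTE.
  by case: (side y); case: (side z); rewrite /= ?e2 ?e3 ?eqxx ?ne.
by apply: cut_T; rewrite -gen_adj; exact: adj_T.
Qed.

(** A chain of mixed blocks from i to j expresses D_ij as a product of
    matching blocks that already belong to the algebra. *)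
Lemma block_D_T i j : linked cl i j -> block_mat 0 (delta_mx i j) \in T.
Proof.
rewrite (class_ix_linked x qtS) => /andP[iA /connectP[s s_path ->]] {j}.
have: linked cl i i /\ block_mat 0 (delta_mx i i) \in T.
  by have mii := mixed_refl x qtS iA; split;
    [exact: mixed_linked | exact: block_D_mixed].
move: {1 3 5 7}i s_path => k; elim: s k => [|m s IH] k /=; first by move=> _ [].
case/andP=> mkm s_path [ik ikT]; apply: IH s_path _.
have km := mixed_linked mkm.
have E : block_mat 0 (delta_mx i k) *m block_mat 0 (delta_mx k m)
    = block_mat 0 (delta_mx i m).
  rewrite block_matM; try exact: linked_delta.
  by rewrite !(mul0mx, mulmx0) !addr0 mul_delta_mx.
split.
  case/andP: ik km => /eqP ik i0 /andP[/eqP km k0].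
  by rewrite linkedE ik km eqxx -km.
rewrite -E; apply: (@memvM _ (MX F X) T) => //; exact: block_D_mixed.
Qed.

Lemma block_T f g : linked_mx cl g -> block_mat f g \in T.
Proof.
move=> lg.
have lin_j : linear (fun f => block_mat f 0 : MX F X).
  by move=> s u v; apply/matrixP=> a b; rewrite !mxE /blockf !mxE; ring.
have lin_d : linear (fun g => block_mat 0 g : MX F X).
  by move=> s u v; apply/matrixP=> a b; rewrite !mxE /blockf !mxE; ring.
have -> : block_mat f g = mklin lin_j f + mklin lin_d g.
  by apply/matrixP=> a b; rewrite !mxE /blockf !mxE; ring.
rewrite [f]matrix_sum_delta [g]matrix_sum_delta; apply: memvD.
  rewrite linear_sum; apply: memv_suml => i _; rewrite linear_sum.
  by apply: memv_suml => j _; rewrite linearZ memvZ //; exact: block_J_T.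
rewrite linear_sum; apply: memv_suml => i _; rewrite linear_sum.
apply: memv_suml => j _; have [ij|/lg ->] := boolP (linked cl i j).
  by rewrite linearZ memvZ //; exact: block_D_T.
by rewrite scale0r linear0 mem0v.
Qed.

Lemma terwilligerP M :
  reflect (linked_mx cl (match_coord M)
    /\ M = block_mat (ones_coord M) (match_coord M)) (M \in T).
Proof.
apply: (iffP idP) => [/(subvP terwilliger_sub)/block_spaceP[f [g [lg ->]]]|[lg ->]].
  by rewrite ones_coord_block ?match_coord_block.
exact: block_T.
Qed.

Lemma ones_coord_linear : linear (fun u : subvs_of T => ones_coord (vsval u)).
Proof. by move=> s u v; apply/matrixP=> i j; rewrite !mxE /entry !mxE. Qed.

Lemma match_coord_linear : linear (fun u : subvs_of T => match_coord (vsval u)).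
Proof. by move=> s u v; apply/matrixP=> i j; rewrite !mxE /entry !mxE; ring. Qed.

Lemma match_coord_linked (u : subvs_of T) : linked_mx cl (match_coord (vsval u)).
Proof. by have /terwilligerP[] := subvsP u. Qed.

Lemma vsval_block (u : subvs_of T) :
  vsval u = block_mat (ones_coord (vsval u)) (match_coord (vsval u)).
Proof. by have /terwilligerP[] := subvsP u. Qed.

Definition of_blocks f g : subvs_of T := vsproj T (block_mat f g : MX F X).

Lemma vsval_of_blocks f g : linked_mx cl g -> vsval (of_blocks f g) = block_mat f g.
Proof. by move=> lg; rewrite vsprojK ?block_T. Qed.

Lemma of_blocksK (u : subvs_of T) :
  of_blocks (ones_coord (vsval u)) (match_coord (vsval u)) = u.
Proof. by rewrite /of_blocks -vsval_block vsvalK. Qed.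

Lemma vsvalM (u v : subvs_of T) : vsval (u * v) =
  block_mat (ones_coord (vsval u) *m size_mx F cl *m ones_coord (vsval v)
             + match_coord (vsval u) *m ones_coord (vsval v)
             + ones_coord (vsval u) *m match_coord (vsval v))
    (match_coord (vsval u) *m match_coord (vsval v)).
Proof.
rewrite -block_matM; try exact: match_coord_linked.
by rewrite -!vsval_block.
Qed.

Lemma ones_coord_of_blocks f g :
  linked_mx cl g -> ones_coord (vsval (of_blocks f g)) = f.
Proof. by move=> lg; rewrite vsval_of_blocks // ones_coord_block. Qed.

Lemma match_coord_of_blocks f g :
  linked_mx cl g -> match_coord (vsval (of_blocks f g)) = g.
Proof. by move=> lg; rewrite vsval_of_blocks // match_coord_block. Qed.

Lemma match_coord_mul (u v : subvs_of T) :
  match_coord (vsval (u * v)) = match_coord (vsval u) *m match_coord (vsval v).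
Proof.
by rewrite vsvalM match_coord_block //; apply: linked_mxM; exact: match_coord_linked.
Qed.

Lemma ones_coord_mul (u v : subvs_of T) : ones_coord (vsval (u * v)) =
  ones_coord (vsval u) *m size_mx F cl *m ones_coord (vsval v)
  + match_coord (vsval u) *m ones_coord (vsval v)
  + ones_coord (vsval u) *m match_coord (vsval v).
Proof.
by rewrite vsvalM ones_coord_block //; apply: linked_mxM; exact: match_coord_linked.
Qed.

Definition terwilliger_coords : pair_coords cl (subvs_of T) :=
  @PairCoords F d.+1 _ cl (subvs_of T)
    (mklin ones_coord_linear) (mklin match_coord_linear) of_blocks
    match_coord_linked ones_coord_of_blocks match_coord_of_blocks of_blocksK
    match_coord_mul ones_coord_mul.

Lemma block_mat_tr f g : (block_mat f g)^T = block_mat f^T g^T.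
Proof. by apply/matrixP=> a b; rewrite !mxE /blockf !mxE eq_sym. Qed.

Lemma linked_mx_tr g : linked_mx cl g -> linked_mx cl g^T.
Proof.
move=> lg i j ij; rewrite mxE lg //; apply: contra ij.
by rewrite !linkedE => /andP[/eqP <- ->]; rewrite eqxx.
Qed.

Definition tr_blocks (u : subvs_of T) : subvs_of T :=
  of_blocks (ones_coord (vsval u))^T (match_coord (vsval u))^T.

Lemma vsval_tr (u : subvs_of T) : vsval (tr_blocks u) = (vsval u)^T.
Proof.
rewrite vsval_of_blocks; last exact/linked_mx_tr/match_coord_linked.
by rewrite -block_mat_tr -vsval_block.
Qed.

Lemma tr_blocks_linear : linear tr_blocks.
Proof.
by move=> s u v; apply: val_inj; rewrite [LHS]vsval_tr !linearP /= !vsval_tr.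
Qed.

End Matrices.

Theorem theorem2p11 (R : fieldType) (d : nat) (X : finType) (S : scheme d X)
    (x : X) (qtS : quasi_thin S) :
  let T : falgType R := subvs_of (terwilliger R S x) in
  (quasi_hereditary T /\
   exists t : {linear T -> T},
     (forall a : T, vsval (t a) = (vsval a)^T) /\ cellular_wrt t) /\
  (2%N \in [pchar R] ->
   let Lam := Lambda R #|sim_classes S| in
   (exists (n : nat) (P : 'I_n -> lmodType T), complete_proj_indec P) /\
   forall (n : nat) (P : 'I_n -> lmodType T),
     complete_proj_indec P -> end_alg_iso (dirsum P) Lam).
Proof.
pose co := terwilliger_coords R x qtS; pose clK := class_repK x qtS.
split; first split.
- exact: coords_quasi_hereditary clK co.
- pose t := mklin (@tr_blocks_linear R d X S x qtS); exists t.
  split; first exact: vsval_tr.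
  apply: (cells_cellular (co := co)) => u.
    by apply: ones_coord_of_blocks => //; exact/linked_mx_tr/match_coord_linked.
  by apply: match_coord_of_blocks => //; exact/linked_mx_tr/match_coord_linked.
move=> char2; have two0 : 2%:R = 0 :> R by exact: pcharf0.
split; last by move=> n P; exact: (basic_algebra_Lambda clK co).
exists _, (fun v => principal (vertex_idem (@class_rep d X S) co v)).
exact: vertex_complete.
Qed.
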